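(* Let $A$ be a finite set of items and $\mathcal{F}$ an antimonotonic, triangulated and clique-safe family of itemsets over $A$ whose dependency graph $G$ is connected, and let $B\subseteq A$. Then there exists a junction tree $T$ of $G$ such that the safe set containing $B$ of minimum cardinality (among safe sets containing $B$) is precisely the set consisting of the items of $B$ and the items of the inner separators of $B$ with respect to $T$.
   Context: An itemset is a subset of $A=\{a_1,\dots,a_K\}$; $S_U(z)=1$ iff $z_i=1$ for all $a_i\in U$. $\mathcal{F}$ is antimonotonic if closed under subsets. A distribution $p$ on $\{0,1\}^K$ satisfies $\theta=(\theta_U)_{U\in\mathcal{F}}$ if $E_p[S_U]=\theta_U$ for all $U\in\mathcal{F}$; ''frequencies for $\mathcal{F}$'' are such $\theta$ satisfied by some distribution. $C\subseteq A$ is safe if for all frequencies $\theta$ for $\mathcal{F}$, every distribution $q$ on $\{0,1\}^C$ with $E_q[S_U]=\theta_U$ for all $U\in\mathcal{F}$, $U\subseteq C$, has an extension $p$ on $\{0,1\}^K$ (its marginal on the coordinates in $C$ equals $q$) satisfying $\theta$. The dependency graph $G$ has vertex set $A$ and edges $\{a_i,a_j\}$ ($i\ne j$) with $\{a_i,a_j\}\in\mathcal{F}$. $\mathcal{F}$ is triangulated if $G$ has no chordless cycle of length $\ge4$. $\mathcal{F}$ is clique-safe if for every maximal clique $V$ of $G$, every proper subset of $V$ belongs to $\mathcal{F}$. The clique graph has the maximal cliques of $G$ as vertices, two being adjacent iff they share an item. A junction tree is a spanning tree $T$ of the clique graph with the running intersection property: if two cliques contain an item, every clique on the $T$-path between them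 contains it. Each edge of $T$ is a separator, associated with the set of items common to its two cliques. Given $B$, choose for each $b\in B$ a clique $Q_b$ of $T$ with $b\in Q_b$; the inner separators are the separators lying on the $T$-path from $Q_b$ to $Q_c$ for some $b,c\in B$, where the $Q_b$ are chosen so that the number of inner separators is as small as possible (the resulting set of inner separators does not depend on the minimising choice). *)

(* Defs.v *)
From HB Require Import structures.
From mathcomp Require Import all_boot all_algebra.
From mathcomp Require Import boolp reals.

Set Implicit Arguments.
Unset Strict Implicit.
Unset Printing Implicit Defensive.

Import GRing.Theory Num.Theory.

Local Open Scope ring_scope.

Section Distributions.
Variables (R : realType) (I : finType).

Definition distribution (p : {ffun I -> bool} -> R) : Prop :=
  (forall z, 0 <= p z) /\ \sum_z p z = 1.

Definition all_ones (U : {set I}) (z : {ffun I -> bool}) : bool :=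
  [forall a in U, z a].

Definition expect (p f : {ffun I -> bool} -> R) : R := \sum_z p z * f z.

Definition frequency (p : {ffun I -> bool} -> R) (U : {set I}) : R :=
  expect p (fun z => (all_ones U z)%:R).

End Distributions.

Section SafeSets.
Variables (R : realType) (A : finType).
Implicit Types (F : {set {set A}}) (C U : {set A}) (theta : {set A} -> R).

Definition antimonotonic F : Prop :=
  forall U W : {set A}, W \in F -> U \subset W -> U \in F.

(* Only the values of theta on F matter. *)
Definition satisfies F theta (p : {ffun A -> bool} -> R) : Prop :=
  forall U, U \in F -> frequency p U = theta U.

Definition frequencies_for F theta : Prop :=
  exists p, distribution p /\ satisfies F theta p.

Definition restrict C (z : {ffun A -> bool}) : {ffun {a | a \in C} -> bool} :=
  [ffun i => z (val i)].

Definition marginal C (p : {ffun A -> bool} -> R)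
    (w : {ffun {a | a \in C} -> bool}) : R :=
  \sum_(z | restrict C z == w) p z.
Arguments marginal : clear implicits.

(* An itemset U included in C, seen as a set of coordinates of {0,1}^C. *)
Definition itemset_in C U : {set {a | a \in C}} := [set i | val i \in U].

Definition safe F C : Prop :=
  forall theta, frequencies_for F theta ->
  forall q : {ffun {a | a \in C} -> bool} -> R, distribution q ->
    (forall U, U \in F -> U \subset C ->
       frequency q (itemset_in C U) = theta U) ->
  exists p, [/\ distribution p, marginal C p =1 q & satisfies F theta p].

Definition minimum_safe_set F (B C : {set A}) : Prop :=
  [/\ safe F C, B \subset C &
      forall D : {set A}, safe F D -> B \subset D -> (#|C| <= #|D|)%N].

End SafeSets.

Section Graphs.
Variables (V : finType) (e : rel V).

Definition connected_graph : Prop := forall x y, connect e x y.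

Definition chordless_cycle (c : seq V) : Prop :=
  ucycle e c /\
  {in c &, forall x y, e x y -> (y == next c x) || (x == next c y)}.

Definition is_clique (K : {set V}) : bool :=
  [forall x in K, forall y in K, (x != y) ==> e x y].

Definition maximal_clique (K : {set V}) : bool := maxset is_clique K.

(* In a loopless undirected graph, [:: x; y] satisfies [ucycle e] as soon as
   x and y are adjacent; genuine cycles have at least three vertices. *)
Definition acyclic : Prop := forall c, ucycle e c -> (size c < 3)%N.

Definition tree : Prop :=
  [/\ symmetric e, irreflexive e, connected_graph & acyclic].

(* x :: p is a path from x to y without repeated vertices. *)
Definition simple_path (x y : V) (p : seq V) : Prop :=
  [/\ path e x p, last x p = y & uniq (x :: p)].

Definition path_edges (x : V) (p : seq V) : seq {set V} :=
  pairmap (fun u v => [set u; v]) x p.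

End Graphs.

Section JunctionTrees.
Variable A : finType.
Implicit Types (F : {set {set A}}) (B : {set A}).

Definition dependency_graph F : rel A :=
  fun x y => (x != y) && ([set x; y] \in F).

Definition triangulated F : Prop :=
  forall c, chordless_cycle (dependency_graph F) c -> (size c < 4)%N.

Definition clique_safe F : Prop :=
  forall K : {set A}, maximal_clique (dependency_graph F) K ->
  forall U : {set A}, U \proper K -> U \in F.

Record clique F := Clique {
  items : {set A};
  items_maximal : maximal_clique (dependency_graph F) items }.

HB.instance Definition _ F := [isSub for @items F].
HB.instance Definition _ F := [Finite of clique F by <:].

Definition clique_graph F : rel (clique F) :=
  fun K L => (K != L) && (items K :&: items L != set0).

Definition running_intersection F (T : rel (clique F)) : Prop :=
  forall (a : A) (K L : clique F) (p : seq (clique F)),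
    a \in items K -> a \in items L -> simple_path T K L p ->
    {in p, forall M, a \in items M}.

Definition junction_tree F (T : rel (clique F)) : Prop :=
  [/\ tree T, subrel T (@clique_graph F) & running_intersection T].

(* The values of Q outside of B are irrelevant. *)
Definition clique_choice F B (Q : A -> clique F) : Prop :=
  {in B, forall b, b \in items (Q b)}.

(* A separator is an edge {K, L} of T, not the set of items K :&: L, which
   several edges may have in common. *)
Definition inner_separators F (T : rel (clique F)) B (Q : A -> clique F) :
    {set {set clique F}} :=
  [set s | `[< exists b c p, [/\ b \in B, c \in B,
                 simple_path T (Q b) (Q c) p & s \in path_edges (Q b) p] >]].

Definition minimising_choice F (T : rel (clique F)) B (Q : A -> clique F) :
    Prop :=
  clique_choice B Q /\
  forall Q', clique_choice B Q' ->
    (#|inner_separators T B Q| <= #|inner_separators T B Q'|)%N.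

Definition separator_items F (s : {set clique F}) : {set A} :=
  \bigcap_(K in s) items K.

Lemma minimising_choice_exists F (T : rel (clique F)) B :
  exists Q, minimising_choice T B Q.
Proof.
have cov a : exists K : clique F, a \in items K.
  have cl1 : is_clique (dependency_graph F) [set a].
    apply/forall_inP => x /set1P ->; apply/forall_inP => y /set1P ->.
    by rewrite eqxx.
  have [K maxK sK] := maxset_exists cl1.
  by exists (Clique maxK); rewrite (subsetP sK) ?set11.
have [Q0 Q0P] := choice cov.
pose P n := `[< exists Q, clique_choice B Q /\ #|inner_separators T B Q| = n >].
have exP : exists n, P n.
  by exists #|inner_separators T B Q0|; apply/asboolP; exists Q0; split=> // b _.
have [n /asboolP[Q [QB <-]] minQ] := ex_minnP exP.
by exists Q; split=> // Q' Q'B; apply: minQ; apply/asboolP; exists Q'.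
Qed.

End JunctionTrees.

(* Main.v *)
(* Call a set of items convex if no path through its complement joins two of its
   nonadjacent members. Safe sets are exactly the convex ones. If a path outside
   C joins nonadjacent x and y, making all items of the path copies of one coin
   contradicts independent coins for x and y. Conversely, chordality lets a
   convex C grow by one item d at a time so that the neighbours of d in C form a
   clique; clique-safety puts that clique in the family, so its marginal is
   determined and the distributions can be glued along it.

   Convex sets are closed under intersection, so there is a least convex set C0
   containing B, and the same growing argument yields a perfect elimination
   ordering of the items that starts with C0. Order the maximal cliques
   lexicographically with respect to it. Each clique meets the union of its
   predecessors inside one of them, its parent, which gives the tree T. An edge is
   inner for a minimising choice only if the cliques of some b in B all lie
   below it, and then its separator precedes b in the ordering, hence lies in
   C0. Finally, B together with its inner separators is convex for any junction
   tree. *)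

Require Import Defs.
From HB Require Import structures.
From mathcomp Require Import all_boot all_algebra.
From mathcomp Require Import boolp reals.
From mathcomp Require Import zify lra.

Set Implicit Arguments.
Unset Strict Implicit.
Unset Printing Implicit Defensive.

Import GRing.Theory Num.Theory.

(** * Convex sets of a chordal graph *)

Lemma has_split (T : Type) (a : pred T) (s : seq T) : has a s ->
  exists x s1 s2, [/\ s = rcons s1 x ++ s2, a x & ~~ has a s1].
Proof. by case/split_find => x s1 s2 ax ns; exists x, s1, s2. Qed.

Section Chordal.
Variables (A : finType) (e : rel A).
Hypothesis e_sym : symmetric e.
Hypothesis e_irr : irreflexive e.

(** Convexity is relative to an ambient [W], vertices outside [W] counting as deleted for the inside
    of a path; this lets inductions remove vertices. The interior [p] may repeat vertices and the
    path may be closed, whence the case [x = y]. *)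
Definition convex (W C : {set A}) : Prop :=
  forall x y p, x \in C -> y \in C -> path e x (rcons p y) ->
    {in p, forall u, u \in W :\: C} -> x = y \/ e x y.

Lemma convex0 W : convex W set0.
Proof. by move=> x y p; rewrite inE. Qed.

Lemma convexS (W W' C : {set A}) : W' \subset W -> convex W C -> convex W' C.
Proof.
move=> sW cC x y p xC yC pp pW; apply: (cC x y p) => // u /pW.
by apply/subsetP/setSD.
Qed.

(** Induction on the length of the path. Its first inner vertex misses one of the two sets, say [E].
    By convexity of [E], the first return [q] to [E] is [x] or a neighbour of [x], so the detour can
    be cut out. *)
Lemma convexI C D : convex setT C -> convex setT D -> convex setT (C :&: D).
Proof.
move=> cC cD x y p; have [n] := ubnP (size p).
elim: n p x => // n IHn [|u p] x pn xI yI.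
  by rewrite /= andbT => exy; right.
move=> pp pI.
have shortcut E : convex setT E -> x \in E -> y \in E -> u \notin E ->
    x = y \/ e x y.
  move=> cE xE yE uE.
  have hasE : has (mem E) (rcons (u :: p) y).
    by apply/hasP; exists y; rewrite // mem_rcons mem_head.
  have [q [s1 [s2 [qE qinE nE]]]] := has_split hasE.
  move: pp; rewrite qE cat_path last_rcons => /andP[p1 p2].
  have out : {in s1, forall v, v \in setT :\: E}.
    by move=> v vs; rewrite !inE andbT; apply: contra nE => vE; apply/hasP; exists v.
  have e1 := cE _ _ _ xE qinE p1 out.
  case: s1 => [|u1 s1] in qE nE p1 out e1.
    by move: qE => -[uq _]; case/negP: uE; rewrite uq.
  case/lastP: s2 => [|s2 y'] in qE p2.
    by move: qE; rewrite cats0 => /rcons_inj E'; rewrite (congr1 snd E' : y = q).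
  move: qE; rewrite -rcons_cat => /rcons_inj E'.
  have upE : u :: p = rcons (u1 :: s1) q ++ s2 := congr1 fst E'.
  have yE' : y = y' := congr1 snd E'.
  rewrite -yE' in p2.
  have sub v : v \in rcons (u1 :: s1) q ++ s2 -> v \in [set: A] :\: C :&: D.
    by rewrite -upE => /pI.
  have szE : (size s1 + size s2).+2 = (size p).+1.
    by rewrite -[RHS]/(size (u :: p)) upE size_cat size_rcons /= !addSn.
  have s2p : size s2 < size p by rewrite -ltnS -szE !ltnS leq_addl.
  case: e1 => [xq|exq].
    apply: (IHn s2 x) => //; rewrite ?xq //; first exact: ltn_trans s2p pn.
    by move=> v vs; apply: sub; rewrite mem_cat vs orbT.
  apply: (IHn (q :: s2) x) => //=; rewrite ?exq //; first exact: leq_ltn_trans s2p pn.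
  by move=> v vs; apply: sub; rewrite cat_rcons mem_cat vs orbT.
have := pI u (mem_head _ _); rewrite !inE andbT negb_and.
move: xI yI; rewrite !inE => /andP[xC xD] /andP[yC yD].
by case/orP; [apply: (shortcut C) | apply: (shortcut D)].
Qed.

Lemma chordless_cycle_nth (c : seq A) x0 :
  ucycle e c ->
  (forall i j, i < j < size c -> e (nth x0 c i) (nth x0 c j) ->
    j = i.+1 \/ (i = 0 /\ j = (size c).-1)) ->
  chordless_cycle e c.
Proof.
move=> uc noc; split=> // _ _ /(nthP x0)[i ic <-] /(nthP x0)[j jc <-].
have Uc : uniq c by case/andP: uc.
have nextE k : k < size c -> next c (nth x0 c k) = nth x0 c (k.+1 %% size c).
  move=> kc; rewrite next_nth mem_nth //.
  case: c kc {ic jc noc uc} Uc => // y c kc Uc; rewrite index_uniq //.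
  have [->|kn] := eqVneq k (size c).
    by rewrite modnn nth_default.
  rewrite modn_small /=; last by move: kc kn => /=; lia.
  by apply: set_nth_default; move: kc kn => /=; lia.
wlog ij : i j ic jc / i <= j.
  move=> H eij; have [/H|/ltnW ji] := leqP i j; first exact.
  by rewrite orbC; apply: H => //; rewrite e_sym.
have [->|ij' eij] := eqVneq i j; first by rewrite e_irr.
have lij : i < j by rewrite ltn_neqAle ij'.
have [|jE|[iE jE]] := noc i j _ eij; first by rewrite lij.
  by rewrite [next c (nth x0 c i)]nextE // -jE modn_small ?eqxx.
rewrite [next c (nth x0 c j)]nextE // jE prednK ?modnn ?iE ?eqxx ?orbT //.
by apply: leq_ltn_trans ic.
Qed.

Hypothesis chordal : forall c, chordless_cycle e c -> size c < 4.

(** Without a common neighbour, any extra edge among [s], [t] and the vertices of [q] would give a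
    shorter path of the same kind, handled by induction. If there is none, [s], [t] and [q] form a
    chordless cycle of length at least 4. *)
Lemma common_neighbor_on_path s t x0 q :
  e s t -> s \notin q -> t \notin q -> 0 < size q -> sorted e q ->
  e t (nth x0 q 0) -> e s (nth x0 q (size q).-1) ->
  exists2 v, v \in q & e s v /\ e t v.
Proof.
move=> est; have [n] := ubnP (size q).
elim: n q => // n IHn q qn sq tq q0 qs etq esq.
apply: contrapT => none.
have IH r : size r < size q -> {subset r <= q} -> 0 < size r -> sorted e r ->
    e t (nth x0 r 0) -> e s (nth x0 r (size r).-1) -> False.
  move=> sz sub r0 rs etr esr; apply: none.
  have [|||v vr vP] := IHn r _ _ _ r0 rs etr esr; last by exists v; rewrite ?sub.
  - by move: qn sz; lia.
  - by apply: contra sq => /sub.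
  - by apply: contra tq => /sub.
have tnth i : 0 < i < size q -> ~ e t (nth x0 q i).
  move=> /andP[i0 iq] eti; apply: (IH (drop i q)).
  - by rewrite size_drop; lia.
  - by move=> v /mem_drop.
  - by rewrite size_drop; lia.
  - exact: drop_sorted.
  - by rewrite nth_drop addn0.
  - by rewrite nth_drop size_drop (_ : i + _ = (size q).-1) //; lia.
have snth i : i < (size q).-1 -> ~ e s (nth x0 q i).
  move=> iq esi; have szt : size (take i.+1 q) = i.+1 by rewrite size_takel //; lia.
  apply: (IH (take i.+1 q)).
  - by rewrite szt; lia.
  - by move=> v /mem_take.
  - by rewrite szt.
  - exact: take_sorted.
  - by rewrite nth_take.
  - by rewrite szt nth_take.
have qnth i j : i.+1 < j < size q -> ~ e (nth x0 q i) (nth x0 q j).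
  move=> /andP[ij jq] eij.
  have szt : size (take i.+1 q) = i.+1 by rewrite size_takel //; lia.
  have rE k : nth x0 (take i.+1 q ++ drop j q) k =
      if k < i.+1 then nth x0 q k else nth x0 q (j + (k - i.+1)).
    by rewrite nth_cat szt; case: ifP => [ki|_]; [rewrite nth_take | rewrite nth_drop].
  have szr : size (take i.+1 q ++ drop j q) = i.+1 + (size q - j).
    by rewrite size_cat szt size_drop.
  apply: (IH (take i.+1 q ++ drop j q)); rewrite ?rE ?szr //.
  - by lia.
  - by move=> v; rewrite mem_cat => /orP[/mem_take|/mem_drop].
  - apply/(sortedP x0) => k; rewrite szr => kr; rewrite !rE.
    have [ki|ik] := ltnP k.+1 i.+1.
      by rewrite ltnW //; move/(sortedP x0): qs; apply; lia.
    have [ki|ik'] := ltnP k i.+1.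
      by rewrite (_ : k = i) ?subnn ?addn0 //; lia.
    rewrite (_ : j + (k.+1 - i.+1) = (j + (k - i.+1)).+1); last by lia.
    by move/(sortedP x0): qs; apply; lia.
  - rewrite ifF; last by lia.
    by rewrite (_ : j + _ = (size q).-1) //; lia.
(* A repeated vertex yields a forbidden edge: the one leaving its second occurrence, or the one to
   [s] if that occurrence is the last vertex. *)
have uq : uniq q.
  apply/(uniqP x0) => i j; rewrite !inE.
  wlog ij : i j / i < j.
    move=> H iq jq E; have [ij|ji|//] := ltngtP i j; first exact: H.
    by apply/esym; apply: H.
  move=> iq jq E; exfalso.
  have [jl|jl] := ltnP j.+1 (size q).
    apply: (@qnth i j.+1); first by lia.
    by rewrite E; move/(sortedP x0): qs; apply.
  apply: (@snth i); first by lia.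
  by rewrite E (_ : j = (size q).-1) //; lia.
have q1 : 1 < size q.
  rewrite ltnNge; apply/negP => q1; apply: none.
  exists (nth x0 q 0); first exact: mem_nth.
  by split=> //; move: esq; rewrite (_ : (size q).-1 = 0) //; lia.
suff /chordal : chordless_cycle e [:: s, t & q] by rewrite /= !ltnS leqNgt q1.
have nst : s != t by apply/eqP => st; rewrite st e_irr in est.
apply: (chordless_cycle_nth (x0 := x0)).
  rewrite /ucycle /= inE negb_or nst sq tq uq est !andbT /=.
  case: q q0 qs etq esq {qn sq tq IHn none IH tnth snth qnth uq q1} => // u q _ /= qs -> esq.
  by rewrite rcons_path qs e_sym; move: esq; rewrite -last_nth.
move=> i j /andP[ij jq].
case: i j ij jq => [|[|i]] [|[|j]] //= ij jq eij.
- by left.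
- right; split=> //; have [jl|] := ltnP j (size q).-1; first by case: (snth j).
  have E n' : j.+2 < n'.+2 -> n'.-1 <= j -> j.+2 = n'.+1 by lia.
  exact: E.
- by have [->|j0] := posnP j; [left | case: (tnth j); rewrite ?j0].
- have [jl|] := leqP j i.+1; first by left; lia.
  by move=> jl; case: (@qnth i j) => //; rewrite jl.
Qed.

(* A vertex of the component with the most neighbours in [S]: the first vertex
   adjacent to a missing [s], on a path starting from it, has strictly more. *)
Lemma clique_dominated (X S : {set A}) d0 :
  let r := [rel u v | [&& e u v, u \in X & v \in X]] in
  d0 \in X -> [disjoint S & X] ->
  {in S &, forall s t, s != t -> e s t} ->
  {in S, forall s, exists2 u, connect r d0 u & e s u} ->
  exists2 d, connect r d0 d & {in S, forall s, e s d}.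
Proof.
move=> r d0X dSX clS nbS.
have r_sym : symmetric r by move=> u v /=; rewrite e_sym [(u \in X) && _]andbC.
have r_conn : connect_sym r by apply: sym_connect_sym.
have connX u : connect r d0 u -> u \in X.
  case/connectP => p; elim/last_ind: p => [_ ->//|p v _].
  by rewrite rcons_path last_rcons => /andP[_ /and3P[_ _ ?]] ->.
pose f d := #|[set s in S | e s d]|.
have [d cd dmax] := @arg_maxnP _ d0 (connect r d0) f (connect0 _ _).
exists d => // s sS; apply: contrapT => nsd.
have [u cu esu] := nbS s sS.
have [p pp up] : exists2 p, path r d p & u = last d p.
  by apply/connectP; rewrite (connect_trans _ cu) // r_conn.
have hs : has (e s) (d :: p) by apply/hasP; exists u; rewrite // up mem_last.
have [v [q1 [q2 [pE esv nq1]]]] := has_split hs.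
case: q1 => [|d' q1] in pE nq1.
  by move: pE => -[dv _]; rewrite dv in nsd.
move: pE => [dd' pE]; rewrite -{d'}dd' in nq1.
move: pp; rewrite pE cat_path => /andP[pp _].
have inX : {subset d :: rcons q1 v <= X}.
  move=> x; rewrite inE => /predU1P[->|xq]; first exact: connX.
  by apply: connX; apply: connect_trans cd _; apply: (path_connect pp); rewrite inE xq orbT.
have cv : connect r d0 v.
  by apply: connect_trans cd _; apply: (path_connect pp); rewrite inE mem_rcons mem_head orbT.
have pe : path e d (rcons q1 v) by apply: sub_path pp => x y /and3P[].
have notinX t : t \in S -> t \notin d :: rcons q1 v.
  by move=> tS; apply/negP => /inX tX; move/pred0P/(_ t): dSX; rewrite /= tS tX.
suff lt : f d < f v by have := leq_trans lt (dmax v cv); rewrite ltnn.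
apply: proper_card; apply/properP; split; last first.
  by exists s; rewrite inE sS ?esv //; apply/negP.
apply/subsetP => t; rewrite !inE => /andP[tS etd]; rewrite tS /=.
have est : e s t by apply: clS => //; apply/eqP => st; rewrite st in nsd.
have [|w wq [esw etw]] := @common_neighbor_on_path s t d (d :: rcons q1 v) est
    (notinX s sS) (notinX t tS) isT pe etd.
  by rewrite /= size_rcons -[nth _ _ _]/(nth d (d :: rcons q1 v) (size q1).+1) /= nth_rcons ltnn eqxx.
move: wq; rewrite -rcons_cons mem_rcons inE => /predU1P[<-//|wq].
by case/negP: nq1; apply/hasP; exists w.
Qed.

(** Let [S] be the neighbours in [C] of the component of [d0] in [W :\: C]. Convexity makes [S] a
    clique, and [clique_dominated] finds [d] in the component adjacent to all of [S]. A path leaving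
    [d] outside [C] can enter [C] only in [S], so adding [d] preserves convexity. *)
Lemma convex_extend (W C : {set A}) :
  convex W C -> (exists d0, d0 \in W :\: C) ->
  exists d, [/\ d \in W :\: C, convex W (d |: C) &
    {in C &, forall s t, e s d -> e t d -> s != t -> e s t}].
Proof.
move=> cC [d0 d0X]; set X := W :\: C in d0X.
pose r := [rel u v | [&& e u v, u \in X & v \in X]].
pose S := [set s in C | [exists u, connect r d0 u && e s u]].
have r_sym : symmetric r by move=> u v /=; rewrite e_sym [(u \in X) && _]andbC.
have r_conn : connect_sym r by apply: sym_connect_sym.
have connX u : connect r d0 u -> u \in X.
  case/connectP => p; elim/last_ind: p => [_ ->//|p v _].
  by rewrite rcons_path last_rcons => /andP[_ /and3P[_ _ ?]] ->.
have inner x y p : path e x p -> {in x :: p, forall u, u \in X} ->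
    y \in x :: p -> connect r x y.
  move=> pp pX yp; apply: (@path_connect _ _ _ p) => //.
  elim: p x pp pX {yp} => //= u p IHp x /andP[exu pu] pX.
  rewrite exu !pX ?IHp ?inE ?eqxx ?orbT // => v vp.
  by apply: pX; rewrite inE vp orbT.
have clS : {in S &, forall s t, s != t -> e s t}.
  move=> s t; rewrite !inE => /andP[sC /existsP[u /andP[cu esu]]].
  move=> /andP[tC /existsP[v /andP[cv etv]]] st.
  have [p pp vE] : exists2 p, path r u p & v = last u p.
    by apply/connectP; rewrite (connect_trans _ cv) // r_conn.
  have [|u' u'p|E|//] := cC s t (u :: p) sC tC; last by rewrite E eqxx in st.
    rewrite /= esu rcons_path -vE e_sym etv andbT.
    by apply: sub_path pp => x y /and3P[].
  by apply: connX; apply: connect_trans cu _; apply: path_connect pp _ u'p.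
have [|s|d cd dS] := clique_dominated d0X (S := S) _ clS.
- apply/pred0P => s /=; rewrite !inE; case: (s \in C) => //=.
  by rewrite andbF.
- by rewrite inE => /andP[_ /existsP[u /andP[cu esu]]]; exists u.
have dX := connX _ cd.
have SP s u : s \in C -> connect r d u -> e s u -> e s d.
  move=> sC cu esu; apply: dS; rewrite inE sC; apply/existsP; exists u.
  by rewrite esu (connect_trans cd).
exists d; split=> //; last first.
  move=> s t sC tC esd etd; apply: clS; rewrite inE ?sC ?tC; apply/existsP; exists d.
    by rewrite cd.
  by rewrite cd.
have toC y p : y \in C -> path e d (rcons p y) ->
    {in p, forall u, u \in W :\: (d |: C)} -> e d y.
  move=> yC pp pW; rewrite e_sym; move: pp; rewrite rcons_path => /andP[pp ey].
  apply: (SP _ (last d p)) => //; last by rewrite e_sym.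
  apply: inner pp _ (mem_last _ _) => u; rewrite inE => /predU1P[->//|/pW].
  by rewrite !inE negb_or => /andP[/andP[_ ->] ->].
move=> x y p; rewrite !inE => /predU1P[->|xC] /predU1P[->|yC] pp pW.
- by left.
- by right; apply: toC pp pW.
- right; rewrite e_sym; apply: (toC x (rev p)) => //; last first.
    by move=> u; rewrite mem_rev; apply: pW.
  have := rev_path e x (rcons p d); rewrite last_rcons belast_rcons rev_cons.
  by move=> ->; apply: sub_path pp => u v; rewrite e_sym.
- apply: (cC x y p) => // u /pW; rewrite !inE negb_or => /andP[/andP[_ ->] ->] //.
Qed.

(** Grow [C] up to [W] with [convex_extend]: for the last vertex added, all neighbours in [W] were
    already present and form a clique. *)
Lemma simplicial_outside (W C : {set A}) :
  C \proper W -> convex W C ->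
  exists2 v, v \in W :\: C &
    {in W &, forall x y, e v x -> e v y -> x != y -> e x y}.
Proof.
have [n] := ubnP #|W :\: C|.
elim: n C => // n IHn C Cn /properP[CW [d0 d0W d0C]] cC.
have [|d [dX cd dcl]] := convex_extend cC.
  by exists d0; rewrite inE d0C.
move: (dX); rewrite inE => /andP[dC dW].
have [E|nE] := eqVneq (d |: C) W.
  exists d => // x y; rewrite -E !inE.
  move=> /predU1P[->|xC] /predU1P[->|yC]; rewrite ?e_irr // => edx edy xy.
  by apply: dcl; rewrite // e_sym.
have sdC : W :\: (d |: C) \subset W :\: C by apply: setDS; apply: subsetUr.
have [||v vX vcl] := IHn (d |: C) _ _ cd.
- suff : #|W :\: (d |: C)| < #|W :\: C| by move: Cn; lia.
  apply: proper_card; apply/properP; split=> //.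
  by exists d; rewrite // !inE eqxx.
- by rewrite properEneq nE subUset sub1set dW.
by exists v; rewrite ?(subsetP sdC).
Qed.

(** Vertices with clique neighbourhoods are peeled off [W], each receiving the largest value still
    free. Those outside [C] are peeled first, so [C] becomes an initial segment. *)
Lemma elimination_ordering (W C : {set A}) :
  C \subset W -> convex W C ->
  exists rho : A -> nat, [/\ {in W &, injective rho},
    {in C & W :\: C, forall x y, rho x < rho y},
    {in W, forall x, rho x < #|W|} &
    {in W & W & W, forall v x y, e v x -> e v y ->
      rho x < rho v -> rho y < rho v -> x != y -> e x y}].
Proof.
have [n] := ubnP #|W|.
elim: n W C => // n IHn W C Wn CW cC.
have step (D : {set A}) v : D \subset W -> convex W D -> v \in W :\: D ->
    {in W &, forall x y, e v x -> e v y -> x != y -> e x y} ->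
  exists rho : A -> nat, [/\ {in W &, injective rho},
    {in D & W :\: D, forall x y, rho x < rho y},
    {in W, forall x, rho x < #|W|} &
    {in W & W & W, forall v x y, e v x -> e v y ->
      rho x < rho v -> rho y < rho v -> x != y -> e x y}].
  move=> DW cD; rewrite inE => /andP[vD vW] vcl.
  have cardW := cardsD1 v W; rewrite vW add1n in cardW.
  have [||rho [rI rD rlt rcl]] := IHn (W :\ v) D _ _ (convexS (subD1set _ _) cD).
  - by move: Wn; rewrite cardW.
  - by rewrite subsetD1 DW.
  have inWv x : x \in W -> x != v -> x \in W :\ v by rewrite !inE => -> ->.
  pose rho' x := if x == v then #|W :\ v| else rho x.
  have rlt' x : x \in W -> rho' x < #|W|.
    by move=> xW; rewrite /rho' cardW; case: eqVneq => // xv; rewrite ltnS ltnW // rlt ?inWv.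
  exists rho'; split=> //.
  - move=> x y xW yW; rewrite /rho'; case: eqVneq => [->|xv]; case: eqVneq => [->//|yv].
    + by move=> E; have := rlt y (inWv _ yW yv); rewrite -E ltnn.
    + by move=> E; have := rlt x (inWv _ xW xv); rewrite E ltnn.
    + by apply: rI; apply: inWv.
  - move=> x y xD; rewrite inE => /andP[yD yW]; rewrite /rho'.
    have xv : x != v by apply: contraNneq vD => <-.
    rewrite (negPf xv); case: eqVneq => [_|yv].
      by apply: rlt; apply: inWv => //; apply: (subsetP DW).
    by apply: rD; rewrite // inE yD inWv.
  - move=> w x y wW xW yW ewx ewy; have [wv|wv] := eqVneq w v.
      by rewrite wv in ewx ewy; move=> _ _; apply: vcl.
    have late u : u \in W -> rho' u < rho' w -> u != v.
      move=> uW; rewrite /rho' (negPf wv); case: eqVneq => // _ lt.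
      by have := ltn_trans lt (rlt w (inWv _ wW wv)); rewrite ltnn.
    move=> xw yw; have xv := late _ xW xw; have yv := late _ yW yw.
    move: xw yw; rewrite /rho' (negPf wv) (negPf xv) (negPf yv).
    by apply: rcl => //; apply: inWv.
have [CW'|] := boolP (C \proper W).
  by have [v] := simplicial_outside CW' cC; apply: step.
rewrite properEneq CW andbT negbK => /eqP CE.
have [->|W0] := eqVneq W set0.
  exists (fun=> 0); split=> [x y|x y|x|v x y]; rewrite ?inE //.
  by rewrite andbF.
(* Only [C] is left. Its vertices are peeled with the empty set as convex part, the condition on
   [W :\: C] being vacuous now. *)
have [|v vX vcl] := @simplicial_outside W set0 _ (@convex0 W).
  by rewrite proper0.
have [rho [rI _ rlt rcl]] := step set0 v (sub0set _) (@convex0 W) vX vcl.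
by exists rho; split=> // x y _; rewrite CE setDv inE.
Qed.

End Chordal.

(** * Rooted trees *)

Section RootedTree.
Variables (V : finType) (par : V -> V) (rank : V -> nat) (root : V).
Hypothesis par_root : par root = root.
Hypothesis rank_par : forall x, x != root -> rank (par x) < rank x.

(** The conjunct [x != y] discards the loop due to [par root = root]. *)
Definition parent_rel : rel V :=
  fun x y => (x != y) && ((par x == y) || (par y == x)).

(** The subtree hanging at [n], with [n] included; removing the edge from [n] to its parent cuts it
    off. *)
Definition below (n x : V) : bool := fconnect par x n.

Lemma belowP n x : reflect (exists k, iter k par x = n) (below n x).
Proof.
apply: (iffP idP) => [bx|[k <-]]; last exact: fconnect_iter.
by exists (findex par x n); apply: iter_findex.
Qed.

Lemma below_refl x : below x x. Proof. exact: connect0. Qed.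

Lemma below_trans y x z : below x y -> below y z -> below x z.
Proof. by move=> xy yz; apply: connect_trans yz xy. Qed.

Lemma below_par n x : x != n -> below n (par x) = below n x.
Proof.
move=> xn; apply/idP/idP => [|/belowP[[|k] xkn]].
- exact: connect_trans (fconnect1 _ _).
- by rewrite -xkn /= eqxx in xn.
- by apply/belowP; exists k; rewrite -iterSr.
Qed.

Lemma below_root x : below root x.
Proof.
have [n] := ubnP (rank x); elim: n x => // n IHn x xn.
have [->|xr] := eqVneq x root; first exact: below_refl.
rewrite -below_par //; apply: IHn.
by apply: leq_trans (rank_par xr) _; rewrite -ltnS.
Qed.

Lemma rank_below n x : below n x -> x != n -> rank n < rank x.
Proof.
move=> /belowP[k]; elim: k x => [|k IHk] x; first by move=> /= ->; rewrite eqxx.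
rewrite iterSr => pxn xn.
have [xr|xr] := eqVneq x root.
  have iter_root j : iter j par root = root by elim: j => //= j ->.
  by move: pxn xn; rewrite xr par_root iter_root => ->; rewrite eqxx.
have [pn|pn] := eqVneq (par x) n; first by rewrite -pn rank_par.
by apply: ltn_trans (IHk _ pxn pn) _; apply: rank_par.
Qed.

Lemma below_anti x y : below x y -> below y x -> x = y.
Proof.
move=> xy yx; apply/eqP; apply: contraT => nxy.
have := rank_below yx nxy; rewrite ltnNge ltnW //.
by apply: rank_below; rewrite // eq_sym.
Qed.

Lemma below_total x m n : below m x -> below n x -> below m n || below n m.
Proof.
move=> /belowP[j <-] /belowP[k <-]; have [jk|/ltnW kj] := leqP j k.
  by apply/orP; right; rewrite -(subnK jk) iterD; apply: fconnect_iter.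
by apply/orP; left; rewrite -(subnK kj) iterD; apply: fconnect_iter.
Qed.

Lemma not_below_par n : n != root -> ~~ below n (par n).
Proof.
move=> nr; apply/negP => bn; have lt := rank_par nr.
have pn : par n != n by apply: contraTneq lt => ->; rewrite ltnn.
by have := ltn_trans lt (rank_below bn pn); rewrite ltnn.
Qed.

Lemma parent_relE x y : parent_rel x y ->
  (x != root /\ y = par x) \/ (y != root /\ x = par y).
Proof.
case/andP=> nxy /orP[] /eqP E; [left | right]; split=> //;
  by apply: contraNneq nxy => r; rewrite -E r par_root.
Qed.

Lemma parent_rel_sym : symmetric parent_rel.
Proof. by move=> x y; rewrite /parent_rel eq_sym orbC. Qed.

Lemma parent_rel_par n : n != root -> parent_rel n (par n).
Proof.
move=> nr; rewrite /parent_rel eqxx andbT.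
by apply: contraTneq (rank_par nr) => <-; rewrite ltnn.
Qed.

Lemma below_cross n x y : parent_rel x y -> below n x != below n y ->
  n != root /\ [set x; y] = [set n; par n].
Proof.
move=> /parent_relE[[xr ->]|[yr ->]].
  have [<-|xn] := eqVneq x n; first by split.
  by rewrite (below_par xn) eqxx.
have [<-|yn] := eqVneq y n; first by rewrite setUC; split.
by rewrite (below_par yn) eqxx.
Qed.

Lemma parent_rel_connected : connected_graph parent_rel.
Proof.
have to_root x : connect parent_rel x root.
  have [n] := ubnP (rank x); elim: n x => // n IHn x xn.
  have [->//|xr] := eqVneq x root.
  apply: connect_trans (connect1 (parent_rel_par xr)) _; apply: IHn.
  by apply: leq_trans (rank_par xr) _; rewrite -ltnS.
move=> x y; apply: connect_trans (to_root x) _.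
by rewrite (sym_connect_sym parent_rel_sym).
Qed.

(** On a cycle, both neighbours of a vertex of largest rank would have to be its parent. *)
Lemma parent_rel_acyclic : acyclic parent_rel.
Proof.
move=> c uc; rewrite ltnNge; apply/negP => sz.
have [x0 x0c] : exists x0, x0 \in c by case: c sz {uc} => // x c _; exists x; rewrite mem_head.
have [m mc mmax] := @arg_maxnP _ x0 (mem c) rank x0c.
have up y : y \in c -> parent_rel m y -> y = par m.
  move=> yc /parent_relE[[]//|[yr E]].
  by have := leq_trans (rank_par yr) (mmax y yc); rewrite -E ltnn.
have [i c' rotE] := rot_to mc.
move: uc; rewrite -(rot_ucycle i) rotE => uc.
have sub y : y \in m :: c' -> y \in c by rewrite -rotE mem_rot.
have sz' : 1 < size c' by rewrite -ltnS -[(size c').+1]/(size (m :: c')) -rotE size_rot.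
case: c' sz' uc sub {rotE} => [|a [|b c']] // _ /andP[cyc uniq_c] sub.
move: cyc => /= /and3P[ma _]; rewrite rcons_path => /andP[_ lm].
have aE : a = par m by apply: up ma; apply: sub; rewrite !inE eqxx orbT.
have lE : last b c' = par m.
  apply: up; last by rewrite parent_rel_sym.
  by apply: sub; rewrite in_cons (in_cons a) mem_last !orbT.
by move: uniq_c; rewrite /= aE -lE mem_last !andbF.
Qed.

Lemma parent_rel_tree : tree parent_rel.
Proof.
split; [exact: parent_rel_sym | by move=> x; rewrite /parent_rel eqxx | |].
  exact: parent_rel_connected.
exact: parent_rel_acyclic.
Qed.

Lemma path_edges_sub (x : V) p s : s \in path_edges x p -> {subset s <= x :: p}.
Proof.
elim: p x => //= y p IHp x; rewrite inE => /predU1P[->|/IHp sub] z.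
  by rewrite !inE => /orP[]->; rewrite ?orbT.
by move/sub; rewrite [in X in _ -> X]inE => ->; rewrite orbT.
Qed.

Lemma crossed_edge x p n : path parent_rel x p ->
  below n x != below n (last x p) -> n != root /\ [set n; par n] \in path_edges x p.
Proof.
elim: p x => [|y p IHp] x /=; first by rewrite eqxx.
move=> /andP[xy yp] nb; have [E|nE] := eqVneq (below n x) (below n y).
  by rewrite E in nb; have [nr sp] := IHp y yp nb; rewrite inE sp orbT.
by have [nr <-] := below_cross xy nE; rewrite inE eqxx.
Qed.

(** An edge separating the ends must be crossed. Conversely, a simple path crosses an edge only
    once, since coming back would revisit an endpoint, so each of its edges separates its ends. *)
Lemma simple_path_edgesP x y p s : simple_path parent_rel x y p ->
  reflect (exists n, [/\ n != root, s = [set n; par n] & below n x != below n y])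
          (s \in path_edges x p).
Proof.
move=> [xp <-] up; apply: (iffP idP) => [|[n [_ -> nb]]]; last first.
  by have [] := crossed_edge xp nb.
elim: p x xp up => //= z p IHp x /andP[xz zp] /andP[xnz up].
rewrite inE => /predU1P[->|sp].
  have [n [nr nE nb]] : exists n, [/\ n != root, [set x; z] = [set n; par n] &
      below n x != below n z].
    case: (parent_relE xz) => [[xr zE]|[zr xE]].
      by exists x; rewrite zE below_refl (negPf (not_below_par xr)).
    by exists z; rewrite xE below_refl (negPf (not_below_par zr)) setUC.
  exists n; split=> //; suff <- : below n z = below n (last z p) by [].
  apply/eqP; apply: contraR xnz => /(crossed_edge zp)[_]; rewrite -nE.
  by move/path_edges_sub; apply; rewrite !inE eqxx.
have [n [nr sE nb]] := IHp z zp up sp; exists n; split=> //.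
suff -> : below n x = below n z by [].
apply/eqP; apply: contraR xnz => /(below_cross xz)[_ E].
by apply: (path_edges_sub sp); rewrite sE -E !inE eqxx.
Qed.

Lemma simple_path_exists x y : exists p, simple_path parent_rel x y p.
Proof.
have /connectP[p xp ->] := parent_rel_connected x y.
by case/shortenP: xp => q xq uq _; exists q.
Qed.

(** * Bags on a rooted tree *)

Variables (A : finType) (bag : V -> {set A}).
(** Rooted form of the running intersection property: the vertices whose bag contains [a] form a
    subtree with top [k]. *)
Hypothesis bag_top : forall a, exists2 k, a \in bag k &
  forall x, a \in bag x -> x != k -> x != root /\ a \in bag (par x).

Lemma bag_top_below a : exists k, [/\ a \in bag k,
  forall x, a \in bag x -> below k x &
  forall x, a \in bag x -> x != k -> a \in bag (par x)].
Proof.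
have [k ak ktop] := bag_top a; exists k; split=> // [x|x ax xk]; last first.
  by case: (ktop x ax xk).
have [j] := ubnP (rank x); elim: j x => // j IHj x xj ax.
have [->|xk] := eqVneq x k; first exact: below_refl.
have [xr apx] := ktop x ax xk; rewrite -below_par //; apply: IHj => //.
by apply: leq_trans (rank_par xr) _; rewrite -ltnS.
Qed.

(** The top of [a] is an ancestor of [y], hence lies outside the subtree at [n]. Climbing from [x]
    to this top passes through [n] and its parent. *)
Lemma bag_cut a n x y : a \in bag x -> a \in bag y -> below n x -> ~~ below n y ->
  a \in bag n /\ a \in bag (par n).
Proof.
have [k [_ to_top step]] := bag_top_below a => ax ay nx ny.
have nk : ~~ below n k by apply: contra ny => nk; apply: below_trans nk (to_top y ay).
suff an : a \in bag n.
  by split=> //; apply: step => //; apply: contraNneq nk => ->; apply: below_refl.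
have /belowP[j] := nx; elim: j x ax {nx} => [|j IHj] x ax; first by move=> <-.
rewrite iterSr => E; apply: (IHj (par x)) => //; apply: step => //.
apply: contraNneq nk => <-; apply/belowP; exists j.+1; by rewrite iterSr.
Qed.

(** If the top of one item is not an ancestor of the top of the other, the edge above the former
    separates the two subtrees, unless its bag contains both items. If each top is an ancestor of
    the other, they coincide. *)
Lemma bag_helly a b : (exists x, a \in bag x /\ b \in bag x) \/
  exists2 n, n != root &
    forall x y, a \in bag x -> b \in bag y -> below n x != below n y.
Proof.
have half c d k l : c \in bag k -> (forall x, c \in bag x -> below k x) ->
    d \in bag l -> ~~ below k l -> (exists x, c \in bag x /\ d \in bag x) \/
    k != root /\ forall x y, c \in bag x -> d \in bag y -> below k x != below k y.
  move=> ck kc dl nkl; have [dk|ndk] := boolP (d \in bag k); first by left; exists k.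
  right; split; first by apply: contraNneq nkl => ->; apply: below_root.
  move=> x y cx dy; rewrite (kc x cx) eq_sym eqb_id; apply: contra ndk => ky.
  by case: (bag_cut dy dl ky nkl).
have [k [ak ka _]] := bag_top_below a; have [l [bl lb _]] := bag_top_below b.
have [kl|kl] := boolP (below k l); last first.
  by have [|[kr H]] := half _ _ _ _ ak ka bl kl; [left | right; exists k].
have [lk|lk] := boolP (below l k); last first.
  have [[x [bx ax]]|[lr H]] := half _ _ _ _ bl lb ak lk; first by left; exists x.
  by right; exists l => // x y ax bY; rewrite eq_sym; apply: H.
by left; exists k; rewrite ak (below_anti kl lk).
Qed.

Lemma bag_path a x y p : a \in bag x -> a \in bag y ->
  simple_path parent_rel x y p -> {in p, forall z, a \in bag z}.
Proof.
move=> ax ay xyp z /splitPr pE; case: pE xyp => p1 p2 xyp.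
have : [set last x p1; z] \in path_edges x (p1 ++ z :: p2).
  by rewrite /path_edges pairmap_cat mem_cat /= mem_head orbT.
case/(simple_path_edgesP _ xyp) => n [nr E nb].
have /setUP[/set1P->|/set1P->] : z \in [set n; par n] by rewrite -E !inE eqxx orbT.
- move: nb; have [nx|nx] := boolP (below n x); rewrite ?(inj_eq negb_inj) /=.
    by case ny: (below n y) => // _; case: (bag_cut ax ay nx (negbT ny)).
  by case ny: (below n y) => // _; case: (bag_cut ay ax ny nx).
- move: nb; have [nx|nx] := boolP (below n x); rewrite ?(inj_eq negb_inj) /=.
    by case ny: (below n y) => // _; case: (bag_cut ax ay nx (negbT ny)).
  by case ny: (below n y) => // _; case: (bag_cut ay ax ny nx).
Qed.

(* The vertex [n] stands for the edge from [n] to its parent. *)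
Definition separated (B : {set A}) (Q : A -> V) (n : V) : Prop :=
  n != root /\ exists b c, [/\ b \in B, c \in B & below n (Q b) != below n (Q c)].

(* A choice crossing the edge above [n] can be pulled back to [par n]. *)
Lemma bag_reroute (B : {set A}) (Q : A -> V) n :
  n != root -> {in B, forall b, b \in bag (Q b)} ->
  {in B, forall b, exists2 x, b \in bag x & ~~ below n x} ->
  exists Q', [/\ {in B, forall b, b \in bag (Q' b)},
    {in B, forall b, ~~ below n (Q' b)} &
    forall m, separated B Q' m -> separated B Q m].
Proof.
move=> nr QB outB; have ng := not_below_par nr.
(* Pulling [y] up to [par n] creates no new separation: an edge between [par n] and an outside
   vertex [z] also separates [y] from [z]. *)
have far m y z : below n y -> ~~ below n z ->
    below m (par n) != below m z -> below m y = below m (par n).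
  move=> ny nz; have [mp|mp] := boolP (below m (par n)).
    by move=> _; apply: below_trans mp _; apply: below_trans ny; apply: fconnect1.
  case mz: (below m z) => // _; apply/negbTE/negP => my.
  case/orP: (below_total my ny) => [mn|nm].
    have [nE|nm] := eqVneq n m; first by rewrite nE mz in nz.
    by rewrite -(below_par nm) (negPf mp) in mn.
  by rewrite (below_trans nm mz) in nz.
exists (fun b => if below n (Q b) then par n else Q b); split.
- move=> b bB; case: ifP => [nb|_]; last exact: QB.
  by have [x bx nx] := outB b bB; case: (bag_cut (QB b bB) bx nb nx).
- by move=> b bB; case: ifPn.
- move=> m [mr [b [c [bB cB H]]]]; split=> //; exists b, c; split=> //; move: H.
  case: ifPn => nb; case: ifPn => nc //.
  + by rewrite eqxx.
  + by move=> H; rewrite (far _ _ _ nb nc H).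
  + by rewrite eq_sym => H; rewrite (far _ _ _ nc nb H) eq_sym.
Qed.

(** The edge above [m] lies entirely on one side of the edge above [n]. Of the two parts it cuts the
    tree into, the one facing away from [n] lies on that same side and contains some [Q b]. *)
Lemma separated_laminar (B : {set A}) (Q : A -> V) n m :
  separated B Q m -> below n m = below n (par m) ->
  exists2 b, b \in B & below n (Q b) = below n m.
Proof.
case=> [_ [b [c [bB cB bc]]]] nm.
wlog [mb mc] : b c bB cB {bc} / below m (Q b) /\ ~~ below m (Q c).
  move=> H; have [mb|mb] := boolP (below m (Q b)).
    by apply: (H b c) => //; split=> //; move: bc; rewrite mb; case: below.
  by apply: (H c b) => //; split=> //; move: bc; rewrite (negPf mb); case: below.
have [bnm|bnm] := boolP (below n m); first by exists b; rewrite ?(below_trans bnm mb).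
have [nc|nc] := boolP (below n (Q c)); last by exists c; rewrite // (negPf nc).
exists b => //; apply/negbTE; apply: contra mc => nb.
by have := below_total mb nb; rewrite (negPf bnm) orbF => mn; apply: below_trans mn nc.
Qed.

End RootedTree.

(** * Lexicographic clique tree *)

Lemma is_cliqueP (V : finType) (e : rel V) (K : {set V}) :
  reflect {in K &, forall x y, x != y -> e x y} (is_clique e K).
Proof.
apply: (iffP forall_inP) => [H x y xK yK|H x xK].
  by apply/implyP; move/forall_inP: (H x xK); apply.
by apply/forall_inP => y yK; apply/implyP; apply: H.
Qed.

Section CliqueTree.
Variables (A : finType) (F : {set {set A}}) (rho : A -> nat).
Local Notation e := (dependency_graph F).
Hypothesis rho_inj : injective rho.
Hypothesis rho_lt : forall x, rho x < #|A|.
Hypothesis rho_elim : forall v x y, e v x -> e v y ->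
  rho x < rho v -> rho y < rho v -> x != y -> e x y.
Implicit Types (K L M : clique F).

Lemma clique_adj K : {in items K &, forall x y, x != y -> e x y}.
Proof. by apply/is_cliqueP; case/maxsetP: (items_maximal K). Qed.

Lemma clique_maximal K L : items K \subset items L -> K = L.
Proof.
move=> KL; apply/val_inj => /=; case/maxsetP: (items_maximal K) => _ H.
by rewrite (H (items L)) //; case/maxsetP: (items_maximal L).
Qed.

Lemma clique_exists (X : {set A}) :
  {in X &, forall x y, x != y -> e x y} -> exists K, X \subset items K.
Proof. by move=> /is_cliqueP/maxset_exists[K mK XK]; exists (Clique mK). Qed.

(* Compares sets lexicographically, lowest [rho] first. *)
Definition weight (X : {set A}) : nat := \sum_(v in X) 2 ^ (#|A| - rho v).

(** A sum of distinct powers of 2 with exponents below [d]; distinctness is the injectivity of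
    [rho]. *)
Lemma weight_tail d (X : {set A}) : d <= #|A| ->
  {in X, forall v, #|A| - d < rho v} -> weight X < 2 ^ d.
Proof.
elim: d X => [|d IHd] X dA Xd.
  rewrite /weight big1 // => v /Xd; rewrite subn0 => /(ltn_trans (rho_lt v)).
  by rewrite ltnn.
pose Y := X :\: [set v | rho v == #|A| - d].
have Yd : weight Y < 2 ^ d.
  apply: IHd => [|v]; first exact: ltnW.
  by rewrite !inE => /andP[vn /Xd]; move: vn; move/eqP; lia.
rewrite /weight (bigID (fun v => rho v == #|A| - d)) /=.
have -> : \sum_(v in X | rho v != #|A| - d) 2 ^ (#|A| - rho v) = weight Y.
  by apply: eq_bigl => v; rewrite !inE andbC.
suff : \sum_(v in X | rho v == #|A| - d) 2 ^ (#|A| - rho v) <= 2 ^ d.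
  by move=> le; rewrite expnS mul2n -addnn -addnS leq_add.
have [v0 /andP[v0X /eqP v0d]|none] := pickP [pred v in X | rho v == #|A| - d].
  rewrite (big_pred1 v0); first by rewrite v0d subKn // ltnW.
  move=> v; apply/andP/eqP => [[_ /eqP vd]|->]; last by rewrite v0d.
  by apply: rho_inj; rewrite vd v0d.
by rewrite big_pred0.
Qed.

Lemma weight_lt m (X Y : {set A}) : m \in Y -> m \notin X ->
  {in X, forall x, rho x < rho m -> x \in Y} -> weight X < weight Y.
Proof.
move=> mY mX XY.
rewrite /weight (bigID (fun v => rho v < rho m)) /= [ltnRHS](bigID (fun v => rho v < rho m)) /=.
rewrite -addnS leq_add //.
  rewrite [leqRHS](bigID (mem X)) /= -[leqLHS]addn0 leq_add //.
  rewrite leq_eqVlt; apply/orP; left; apply/eqP; apply: eq_bigl => v.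
  have [vX|_] := boolP (v \in X); rewrite ?andbF //=.
  by have [vm|_] := boolP (rho v < rho m); rewrite ?andbF //= (XY v vX vm).
rewrite [ltnRHS](bigD1 m) /=; last by rewrite mY ltnn.
apply: ltn_addr.
have -> : \sum_(v in X | ~~ (rho v < rho m)) 2 ^ (#|A| - rho v) =
    weight [set v in X | ~~ (rho v < rho m)].
  by apply: eq_bigl => v; rewrite !inE.
apply: weight_tail => [|v]; first exact: leq_subr.
rewrite !inE -leqNgt => /andP[vX mv]; rewrite subKn; last exact/ltnW/rho_lt.
rewrite ltn_neqAle mv andbT; apply: contraNneq mX => /rho_inj ->; exact: vX.
Qed.

Lemma first_difference (X Y : {set A}) : X != Y ->
  exists2 m, (m \in X) != (m \in Y) &
    forall x, rho x < rho m -> (x \in X) = (x \in Y).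
Proof.
move=> XY; have [m0 m0P] : exists m, (m \in X) != (m \in Y).
  apply/existsP; apply: contraNT XY; rewrite negb_exists => /forallP H.
  by apply/eqP/setP => v; move/(_ v): H; rewrite negbK => /eqP.
have [m mP mmin] := @arg_minnP _ m0 (fun v => (v \in X) != (v \in Y)) rho m0P.
exists m => // x xm; apply/eqP; apply: contraTT xm => /mmin.
by rewrite -leqNgt.
Qed.

Lemma weight_first (X Y : {set A}) : weight X < weight Y ->
  exists m, [/\ m \in Y, m \notin X & forall x, rho x < rho m -> (x \in X) = (x \in Y)].
Proof.
move=> XY; have [|m mP mmin] := @first_difference X Y.
  by apply: contraTneq XY => ->; rewrite ltnn.
have [mX|mX] := boolP (m \in X); last first.
  by exists m; split=> //; move: mP; rewrite (negPf mX); case: (m \in Y).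
have mY : m \notin Y by move: mP; rewrite mX; case: (m \in Y).
have := weight_lt mX mY (fun x xY xm => etrans (mmin x xm) xY).
by rewrite ltnNge ltnW.
Qed.

Lemma weight_inj : injective weight.
Proof.
move=> X Y E; apply/eqP; apply: contraT => /first_difference[m mP mmin].
have [mX|mX] := boolP (m \in X).
  have mY : m \notin Y by move: mP; rewrite mX; case: (m \in Y).
  have := weight_lt mX mY (fun x xY xm => etrans (mmin x xm) xY).
  by rewrite E ltnn.
have mY : m \in Y by move: mP; rewrite (negPf mX); case: (m \in Y).
have := weight_lt mY mX (fun x xX xm => etrans (esym (mmin x xm)) xX).
by rewrite E ltnn.
Qed.

Definition best (X : {set A}) K : Prop :=
  X \subset items K /\ forall M, X \subset items M -> weight (items M) <= weight (items K).

Lemma best_uniq (X : {set A}) K L : best X K -> best X L -> K = L.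
Proof.
move=> [XK Kmax] [XL Lmax]; apply/val_inj/weight_inj/eqP.
by rewrite eqn_leq Lmax ?Kmax.
Qed.

Lemma best_exists (X : {set A}) M : X \subset items M -> exists K, best X K.
Proof.
move=> XM; have [K XK Kmax] :=
  @arg_maxnP _ M (fun K => X \subset items K) (fun K => weight (items K)) XM.
by exists K; split.
Qed.

Definition prefix K n : {set A} := [set x in items K | rho x < n].

Lemma prefix_sub K n : prefix K n \subset items K.
Proof. by apply/subsetP => x; rewrite inE => /andP[]. Qed.

Lemma prefix0 K : prefix K 0 = set0.
Proof. by apply/setP => x; rewrite !inE andbF. Qed.

Lemma best_prefix_self K : exists n, `[< best (prefix K n) K >].
Proof.
exists #|A|; apply/asboolP; split=> [|M]; first exact: prefix_sub.
suff -> : prefix K #|A| = items K by move=> /clique_maximal->.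
by apply/setP => x; rewrite inE rho_lt andbT.
Qed.

(* At its birth [K] becomes the best clique for the part of [K] seen so far; what
   was seen just before is the separator between [K] and its parent. *)
Definition birth K : nat := ex_minn (best_prefix_self K).

Lemma birth_best K : best (prefix K (birth K)) K.
Proof. by rewrite /birth; case: ex_minnP => n /asboolP. Qed.

Lemma birth_min K n : best (prefix K n) K -> birth K <= n.
Proof. by rewrite /birth; case: ex_minnP => m _ mmin bn; apply: mmin; apply/asboolP. Qed.

(* If [m] is the first difference of [M] and [K], then the elements of [K] up
   to its birth are neighbours of [z] or [z] itself, as is [m]: adding [m] to
   them gives a clique, against the choice of [K]. *)
Lemma earlier_clique K M z : weight (items K) < weight (items M) ->
  z \in items K -> z \in items M -> rho z < (birth K).-1.
Proof.
move=> KM zK zM; rewrite ltnNge; apply/negP => bz.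
have [Kbest Kmax] := birth_best K.
have [m [mM mK mmin]] := weight_first KM.
have nsub : ~~ (prefix K (birth K) \subset items M).
  by apply: contraL KM => /Kmax; rewrite -leqNgt.
have [k kP kM] := subsetPn nsub.
move: kP; rewrite inE => /andP[kK kb].
have mk : rho m < rho k.
  rewrite ltn_neqAle; apply/andP; split.
    by apply: contraNneq mK => /rho_inj->.
  by rewrite leqNgt; apply: contra kM => /mmin <-.
have le_z x : rho x < birth K -> rho x <= rho z.
  by move=> xb; apply: leq_trans bz; rewrite -ltnS; apply: leq_trans xb (leqSpred _).
have mz : rho m < rho z := leq_trans mk (le_z k kb).
have ezm : e z m by apply: (clique_adj zM mM); apply: contraNneq mK => <-.
have madj x : x \in prefix K (birth K) -> e m x /\ e x m.
  rewrite inE => /andP[xK xb].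
  have e_sym u v : e u v -> e v u.
    by rewrite /dependency_graph eq_sym setUC.
  have [xz|xz] := eqVneq x z; first by rewrite xz; split=> //; apply: e_sym.
  have xltz : rho x < rho z by rewrite ltn_neqAle (inj_eq rho_inj) xz le_z.
  have ezx : e z x by apply: (clique_adj zK xK); rewrite eq_sym.
  have mx : m != x by apply: contraNneq mK => ->.
  have emx := rho_elim ezm ezx mz xltz mx.
  by split=> //; apply: e_sym.
have [|M' M'sub] := @clique_exists (m |: prefix K (birth K)).
  move=> x y; rewrite !in_setU1 => /predU1P[->|xP] /predU1P[->|yP] xy.
  - by rewrite eqxx in xy.
  - by case: (madj y yP).
  - by case: (madj x xP).
  - by apply: (@clique_adj K) => //; [move: xP | move: yP]; rewrite inE => /andP[].
have sub : prefix K (birth K) \subset items M' by apply: subset_trans M'sub; apply: subsetUr.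
have := Kmax M' sub; rewrite leqNgt => /negP; apply.
apply: (@weight_lt m) => //; first by apply: (subsetP M'sub); rewrite !inE eqxx.
move=> x xK xm; apply: (subsetP sub); rewrite inE xK /=.
by apply: ltn_trans xm (ltn_trans mk kb).
Qed.

(** The third clause is [bag_top], the top of [a] being the heaviest clique containing it. The last
    clause will keep the items of inner separators inside an initial segment of [rho]. *)
Lemma clique_tree : exists (par : clique F -> clique F) (rank : clique F -> nat) root,
  [/\ par root = root,
      forall K, K != root -> rank (par K) < rank K,
      forall a, exists2 K, a \in items K & forall L, a \in items L -> L != K ->
        L != root /\ a \in items (par L) &
      forall K b, K != root -> (forall M, b \in items M -> below par K M) ->
        {in items K :&: items (par K), forall x, rho x < rho b}].
Proof.
have [|K0 _] := @clique_exists set0; first by move=> x y; rewrite inE.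
have [root rootP] := best_exists (sub0set (items K0)).
(* The parent is the best clique for what was seen of [K] just before its birth. *)
have par_ex K : exists L, best (prefix K (birth K).-1) L.
  exact: best_exists (prefix_sub _ _).
have [par parP] := choice par_ex.
have birth_gt0 K : K != root -> 0 < birth K.
  move=> Kr; rewrite lt0n; apply: contraNneq Kr => b0; apply/eqP.
  by apply: best_uniq rootP; have := birth_best K; rewrite b0 prefix0.
have wt_par K : K != root -> weight (items K) < weight (items (par K)).
  move=> Kr; have [_ Pmax] := parP K.
  rewrite ltn_neqAle Pmax ?prefix_sub // andbT.
  apply: contraTneq (birth_gt0 K Kr) => /weight_inj/val_inj KP.
  have /birth_min : best (prefix K (birth K).-1) K by rewrite [X in best _ X]KP.
  by rewrite -leqNgt; case: (birth K) => // n; rewrite ltnn.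
(* The root is best for the empty prefix, so its birth is 0; as [0.-1 = 0], it is its own parent. *)
have par_root : par root = root.
  have r0 : birth root = 0.
    by apply/eqP; rewrite -leqn0; apply: birth_min; rewrite prefix0.
  by have := parP root; rewrite r0 prefix0 => /best_uniq; apply.
(* Parents are heavier, so the weight is subtracted from its maximum to get a rank that drops
   towards the root. *)
have rank_par : forall K, K != root ->
    \max_(M : clique F) weight (items M) - weight (items (par K)) < \max_(M : clique F) weight (items M) - weight (items K).
  move=> K Kr; have lt := wt_par K Kr; apply: ltn_sub2l => //.
  by apply: leq_trans lt _; apply: (leq_bigmax (par K)).
exists par, (fun K => \max_(M : clique F) weight (items M) - weight (items K)), root; split=> //.
  move=> a; have [|K1 K1a] := @clique_exists [set a].
    by move=> x y /set1P-> /set1P->; rewrite eqxx.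
  have [K [aK Kmax]] := best_exists K1a; rewrite sub1set in aK.
  exists K => // L aL LK.
  have LltK : weight (items L) < weight (items K).
    rewrite ltn_neqAle Kmax ?sub1set // andbT.
    by apply: contraNneq LK => /weight_inj/val_inj->.
  split.
    by apply: contraTneq LltK => ->; rewrite -leqNgt; apply: rootP.2; apply: sub0set.
  by apply: (subsetP (parP L).1); rewrite inE aL; apply: earlier_clique LltK aL aK.
move=> K b Kr bK x /setIP[xK xP].
have sx : rho x < (birth K).-1 by apply: earlier_clique (wt_par K Kr) xK xP.
(* Births do not increase towards the root. If [b] came before the last step to the birth of [K],
   every clique containing [b] would pass it to its parent; climbing would carry [b] to [K] and on
   to [par K], which is not below [K]. *)
apply: leq_trans sx _; rewrite leqNgt; apply/negP => bs.
have birth_par M : M != root -> birth (par M) <= birth M.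
  move=> Mr; have [sP Pmax] := parP M; apply: leq_trans (leq_pred _); apply: birth_min.
  split=> [|L]; first exact: prefix_sub.
  move=> sL; apply: Pmax; apply: subset_trans sL; apply/subsetP => y yM.
  by rewrite inE (subsetP sP) //; move: yM; rewrite inE => /andP[].
have birth_below M : below par K M -> birth K <= birth M.
  move=> /belowP[j]; elim: j M => [|j IHj] M; first by move=> <-.
  rewrite iterSr => /IHj le; have [Mr|Mr] := eqVneq M root.
    by move: le; rewrite Mr par_root.
  exact: leq_trans le (birth_par M Mr).
have stays M : b \in items M -> b \in items (par M).
  move=> bM; apply: (subsetP (parP M).1); rewrite inE bM /=.
  apply: leq_trans bs _; have := birth_below M (bK M bM); lia.
have [|M1] := @clique_exists [set b].
  by move=> u v /set1P-> /set1P->; rewrite eqxx.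
rewrite sub1set => bM1.
have bKin : b \in items K.
  have /belowP[j <-] := bK M1 bM1.
  by elim: j => //= j; apply: stays.
have := not_below_par par_root rank_par Kr.
by rewrite (bK _ (stays K bKin)).
Qed.

End CliqueTree.

(** * Gluing distributions *)

Section Gluing.
Local Open Scope ring_scope.
Variable R : realType.

Definition pushforward (X T : finType) (mu : X -> R) (g : X -> T) (z : T) : R :=
  \sum_(x | g x == z) mu x.

Lemma sum_pushforward (X T : finType) (mu : X -> R) (g : X -> T) (f : T -> R) :
  \sum_z pushforward mu g z * f z = \sum_x mu x * f (g x).
Proof.
rewrite [RHS](partition_big g xpredT) //=; apply: eq_bigr => z _.
by rewrite /pushforward mulr_suml; apply: eq_bigr => x /eqP->.
Qed.

Lemma distribution_pushforward (X I : finType) (mu : X -> R) (g : X -> {ffun I -> bool}) :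
  (forall x, 0 <= mu x) -> \sum_x mu x = 1 -> distribution (pushforward mu g).
Proof.
move=> mu0 mu1; split=> [z|]; first by apply: sumr_ge0.
have := sum_pushforward mu g (fun=> 1); under eq_bigr do rewrite mulr1.
by move=> ->; under eq_bigr do rewrite mulr1.
Qed.

Variable A : finType.
Local Notation Omega := {ffun A -> bool}.

Definition agree (S : {set A}) (z z' : Omega) : bool := [forall a in S, z a == z' a].

Definition depends_on (S : {set A}) (f : Omega -> R) : Prop :=
  forall z z', agree S z z' -> f z = f z'.

(** The marginal on the coordinates in [S], kept as a function on the whole cube so that no separate
    space is needed for each [S]. *)
Definition mass (S : {set A}) (p : Omega -> R) (z : Omega) : R :=
  \sum_(z' | agree S z z') p z'.

Lemma agreeP (S : {set A}) (z z' : Omega) : reflect {in S, z =1 z'} (agree S z z').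
Proof. by apply: (iffP forall_inP) => H a /H => [/eqP|->]. Qed.

Lemma agree_sym (S : {set A}) (z z' : Omega) : agree S z z' = agree S z' z.
Proof. by apply: eq_forallb => a; rewrite eq_sym. Qed.

Lemma agree_trans (S : {set A}) : transitive (agree S).
Proof.
move=> y x z /agreeP xy /agreeP yz; apply/agreeP => a aS.
by rewrite xy ?yz.
Qed.

Lemma agree_refl (S : {set A}) (z : Omega) : agree S z z.
Proof. by apply/agreeP. Qed.

Lemma agreeS (S S' : {set A}) z z' : S \subset S' -> agree S' z z' -> agree S z z'.
Proof. by move=> /subsetP SS' /agreeP H; apply/agreeP => a /SS'/H. Qed.

Lemma depends_onS (S S' : {set A}) f : S \subset S' -> depends_on S f -> depends_on S' f.
Proof. by move=> SS' df z z' /(agreeS SS'); apply: df. Qed.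

Lemma all_ones_depends (S U : {set A}) : U \subset S ->
  depends_on S (fun z => (all_ones U z)%:R).
Proof.
move=> /subsetP US z z' /agreeP zz'; congr ((nat_of_bool _)%:R); apply: eq_forallb => a.
by case: (boolP (a \in U)) => //= /US /zz' ->.
Qed.

Lemma mass_agree (S : {set A}) (p : Omega -> R) z z' : agree S z z' -> mass S p z = mass S p z'.
Proof.
move=> zz'; apply: eq_bigl => y; apply/idP/idP; last exact: agree_trans.
by apply: agree_trans; rewrite agree_sym.
Qed.

Lemma mass_eq0 (S : {set A}) (p : Omega -> R) z : (forall z, 0 <= p z) -> mass S p z = 0 -> p z = 0.
Proof.
by move=> p0 /(psumr_eq0P (fun y _ => p0 y)); apply; apply: agree_refl.
Qed.

(** Inclusion-exclusion: requiring a zero at [a] is requiring nothing minus requiring a one.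
    Induction on the set [N] of prescribed zeros reduces every cell to frequencies. *)
Lemma mass_frequency (S : {set A}) (p q : Omega -> R) :
  (forall U : {set A}, U \subset S -> frequency p U = frequency q U) ->
  mass S p =1 mass S q.
Proof.
move=> pq z0.
pose ind (T N : {set A}) (z : Omega) : R :=
  (all_ones T z && [forall a in N, ~~ z a])%:R.
have indE T N : T :|: N \subset S -> expect p (ind T N) = expect q (ind T N).
  have [n] := ubnP #|N|; elim: n T N => // n IHn T N Nn TN.
  have [N0|[a aN]] := set_0Vmem N.
    have E r : expect r (ind T N) = frequency r T.
      apply: eq_bigr => z _; rewrite /ind N0; congr (_ * (_)%:R).
      rewrite (_ : [forall a in set0, ~~ z a]) ?andbT //.
      by apply/forall_inP => a; rewrite inE.
    by rewrite !E pq //; apply: subset_trans TN; apply: subsetUl.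
  have E r : expect r (ind T N) = expect r (ind T (N :\ a)) - expect r (ind (a |: T) (N :\ a)).
    rewrite /expect -sumrB; apply: eq_bigr => z _; rewrite -mulrBr; congr (_ * _).
    have NE : [forall b in N, ~~ z b] = ~~ z a && [forall b in N :\ a, ~~ z b].
      apply/forall_inP/andP => [H|[za /forall_inP H] b bN].
        by split; [apply: H | apply/forall_inP => b /setD1P[_ /H]].
      by have [->//|ba] := eqVneq b a; apply: H; rewrite !inE ba.
    have TE : all_ones (a |: T) z = z a && all_ones T z.
      apply/forall_inP/andP => [H|[za /forall_inP H] b].
        by split; [apply: H; rewrite !inE eqxx | apply/forall_inP => b bT; apply: H; rewrite !inE bT orbT].
      by move=> /setU1P[->//|/H].
    rewrite /ind NE TE; case: (z a); case: (all_ones T z); case: [forall b in N :\ a, ~~ z b];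
      by rewrite /= ?subrr ?subr0.
  have Na : (#|N :\ a| < n)%N by have := cardsD1 a N; rewrite aN; move: Nn; lia.
  have NaS : N :\ a \subset N by apply: subD1set.
  rewrite !E !IHn //.
    by apply: subset_trans TN; rewrite -setUA subUset sub1set !inE aN orbT setUS.
  by apply: subset_trans TN; apply: setUS.
have E r : mass S r z0 = expect r (ind [set a in S | z0 a] [set a in S | ~~ z0 a]).
  rewrite /mass big_mkcond; apply: eq_bigr => z _; rewrite /ind.
  suff -> : agree S z0 z = all_ones [set a in S | z0 a] z && [forall a in [set a in S | ~~ z0 a], ~~ z a].
    by case: ifP; rewrite ?mulr1 ?mulr0.
  apply/agreeP/andP => [H|[/forall_inP H1 /forall_inP H2] a aS].
    by split; apply/forall_inP => a; rewrite inE => /andP[aS]; rewrite H.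
  case za: (z0 a); first by rewrite H1 // inE aS za.
  by apply/esym/negbTE/H2; rewrite inE aS za.
by rewrite !E indE //; apply/subsetP => a; rewrite !inE => /orP[] /andP[].
Qed.

(* The coupling of [q] and [p] that makes them conditionally independent given
   their common marginal on [C :&: W]. *)
Lemma distribution_glue (C W : {set A}) (p q : Omega -> R) :
  distribution p -> distribution q -> mass (C :&: W) p =1 mass (C :&: W) q ->
  exists r, [/\ distribution r,
    forall f, depends_on C f -> expect r f = expect q f &
    forall f, depends_on W f -> expect r f = expect p f].
Proof.
move=> [p0 p1] [q0 q1]; set S := C :&: W => pq.
have mass0 r z : (forall z, 0 <= r z) -> 0 <= mass S r z by move=> r0; apply: sumr_ge0.
pose mu (x : Omega * Omega) : R := (agree S x.1 x.2)%:R * (q x.1 * p x.2 / mass S p x.2).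
pose g (x : Omega * Omega) : Omega := [ffun a => if a \in C then x.1 a else x.2 a].
have mu0 x : 0 <= mu x by rewrite !(mulr_ge0, invr_ge0, ler0n) ?mass0.
have qE f : depends_on C f -> expect (pushforward mu g) f = expect q f.
  move=> fC; rewrite /expect sum_pushforward -(pair_bigA _ (fun u v => mu (u, v) * f (g (u, v)))) /=.
  apply: eq_bigr => u _.
  (* Where the common mass is 0, both [p] and [q] vanish, so the division in [mu] does no harm.
     Elsewhere the weights [p v / mass S p u] sum to 1 over the class of [u]. *)
  have [m0|m0] := eqVneq (mass S p u) 0.
    rewrite (@mass_eq0 S q u) -?pq // mul0r big1 // => v _.
    by rewrite /mu /= (@mass_eq0 S q u) -?pq // !(mul0r, mulr0).
  transitivity (\sum_(v | agree S u v) p v * (q u * f u / mass S p u)).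
    rewrite [RHS]big_mkcond; apply: eq_bigr => v _; rewrite /mu /=.
    case: ifP => uv; rewrite ?mul0r // mul1r -(mass_agree p uv).
    rewrite (fC (g (u, v)) u); last by apply/agreeP => a aC; rewrite ffunE aC.
    by rewrite -!mulrA [RHS]mulrCA; congr (_ * (_ * _)); rewrite mulrC.
  by rewrite -mulr_suml -/(mass S p u) mulrC mulfVK.
have pE f : depends_on W f -> expect (pushforward mu g) f = expect p f.
  move=> fW; rewrite /expect sum_pushforward -(pair_bigA _ (fun u v => mu (u, v) * f (g (u, v)))) /=.
  rewrite exchange_big; apply: eq_bigr => v _ /=.
  have [m0|m0] := eqVneq (mass S p v) 0.
    rewrite (@mass_eq0 S p v) // mul0r big1 // => u _.
    by rewrite /mu /= m0 invr0 !(mulr0, mul0r).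
  transitivity (\sum_(u | agree S v u) q u * (p v * f v / mass S p v)).
    rewrite [RHS]big_mkcond; apply: eq_bigr => u _; rewrite /mu /= agree_sym.
    case: ifP => uv; rewrite ?mul0r // mul1r.
    (* On [W] the glued point agrees with [v]: outside [C] by definition of [g], inside [C] because
       [u] and [v] agree on [S]. *)
    rewrite (fW (g (u, v)) v); last first.
      apply/agreeP => a aW; rewrite ffunE; case: ifP => // aC.
      by move/agreeP: uv => -> //; rewrite inE aC.
    by rewrite -!mulrA; congr (_ * (_ * _)); rewrite mulrC.
  by rewrite -mulr_suml -/(mass S q v) -pq mulrC mulfVK.
exists (pushforward mu g); split=> //; split=> [z|]; first exact: sumr_ge0.
have := qE (fun=> 1) (fun _ _ _ => erefl); rewrite /expect.
by under eq_bigr do rewrite mulr1; move=> ->; under eq_bigr do rewrite mulr1.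
Qed.

End Gluing.

(** * Safe sets are convex sets *)

Section SafeConvex.
Local Open Scope ring_scope.
Variables (R : realType) (A : finType) (F : {set {set A}}).
Local Notation e := (dependency_graph F).
Local Notation Omega := {ffun A -> bool}.

Lemma dependency_sym : symmetric e.
Proof. by move=> x y; rewrite /dependency_graph eq_sym setUC. Qed.

Lemma dependency_irr : irreflexive e.
Proof. by move=> x; rewrite /dependency_graph eqxx. Qed.

Hypothesis F_antimonotonic : antimonotonic F.

Lemma itemset_adj (U : {set A}) x y :
  U \in F -> x \in U -> y \in U -> x != y -> e x y.
Proof.
move=> UF xU yU xy; rewrite /dependency_graph xy.
by apply: F_antimonotonic UF _; rewrite subUset !sub1set xU.
Qed.

(** Each step adds [d] and glues [q] with [p] along the neighbours [S] of [d] in [C]. As [S] is a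
    proper part of a maximal clique, all its subsets are in [F], so the two marginals on [S] agree.
    A member of [F] inside [d |: C] lies in [C], or contains [d] and lies in [W]. *)
Lemma extend_distribution (C : {set A}) (p q : Omega -> R) :
  triangulated F -> clique_safe F -> convex e setT C ->
  distribution p -> distribution q ->
  (forall U : {set A}, U \in F -> U \subset C -> frequency q U = frequency p U) ->
  exists r, [/\ distribution r,
    forall f, depends_on C f -> expect r f = expect q f &
    forall U, U \in F -> frequency r U = frequency p U].
Proof.
move=> chordal safeF; have [n] := ubnP #|~: C|.
elim: n C q => // n IHn C q Cn cC pD qD qp.
have [C0|[d0 d0C]] := set_0Vmem (~: C).
  exists q; split=> // U UF; apply: qp => //.
  by apply/subsetP => a _; move/setP/(_ a): C0; rewrite !inE => /negbFE.
have [|d [dC cdC clq]] := convex_extend dependency_sym dependency_irr chordal cC.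
  by exists d0; move: d0C; rewrite !inE andbT.
rewrite !inE andbT in dC.
pose S := [set s in C | e s d]; pose W := d |: S.
have CW : C :&: W = S.
  apply/setP => a; rewrite !inE; have [->|_] := eqVneq a d; first by rewrite (negPf dC).
  by case: (a \in C).
have [|K WK] := @clique_exists _ F W.
  move=> x y /setU1P[->|xS] /setU1P[->|yS]; first by rewrite eqxx.
  - by rewrite dependency_sym; move: yS; rewrite inE => /andP[].
  - by move: xS; rewrite inE => /andP[].
  - by move: xS yS; rewrite !inE => /andP[xC exd] /andP[yC eyd]; apply: clq.
have SF (U : {set A}) : U \subset S -> U \in F.
  move=> US; apply: safeF (items_maximal K) _ _; apply/properP; split.
    by apply: subset_trans WK; apply: subset_trans US _; apply: subsetUr.
  exists d; first by rewrite (subsetP WK) // !inE eqxx.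
  by apply/negP => /(subsetP US); rewrite inE (negPf dC).
have [|r [rD rC rW]] := distribution_glue pD qD (C := C) (W := W).
  rewrite CW; apply: mass_frequency => U US; apply/esym/qp; first exact: SF.
  by apply: subset_trans US _; apply/subsetP => a; rewrite inE => /andP[].
have [||r' [r'D r'C r'F]] := IHn (d |: C) r _ cdC pD rD.
- suff : (#|~: (d |: C)| < #|~: C|)%N by move: Cn; lia.
  apply: proper_card; rewrite properE setCS subsetUr /=.
  by apply/subsetPn; exists d; rewrite !inE ?eqxx.
- move=> U UF UdC; have [dU|dU] := boolP (d \in U).
    apply: rW; apply: all_ones_depends; apply/subsetP => a aU.
    rewrite !inE; have [//|ad] := eqVneq a d.
    have /setU1P[E|aC] := subsetP UdC a aU; first by rewrite E eqxx in ad.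
    by rewrite aC /=; apply: itemset_adj UF aU dU ad.
  have UC : U \subset C.
    apply/subsetP => a aU; have /setU1P[E|//] := subsetP UdC a aU.
    by rewrite -E aU in dU.
  by rewrite -qp //; apply: rC; apply: all_ones_depends.
exists r'; split=> // f fC; rewrite -rC //; apply: r'C.
by apply: depends_onS fC; apply: subsetUr.
Qed.

Lemma convex_safe (C : {set A}) :
  triangulated F -> clique_safe F -> convex e setT C -> safe R F C.
Proof.
move=> chordal safeF cC theta [p [pD pF]] q [q0 q1] qF.
(* Padding with [false] outside [C] is arbitrary: only coordinates in [C] are compared with [q]. *)
pose ext (w : {ffun {a | a \in C} -> bool}) : Omega :=
  [ffun a => if insub a is Some i then w i else false].
have extK : cancel ext (@restrict A C).
  move=> w; apply/ffunP => i; rewrite !ffunE.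
  by case: insubP => [j _ /val_inj->//|]; rewrite (valP i).
have expE f : expect (pushforward q ext) f = \sum_w q w * f (ext w).
  exact: sum_pushforward.
have [||r [rD rC rF]] := @extend_distribution C p (pushforward q ext) chordal safeF cC pD.
- exact: distribution_pushforward.
- move=> U UF UC; rewrite pF // -(qF U UF UC) /frequency expE.
  apply: eq_bigr => w _; congr (_ * (nat_of_bool _)%:R).
  apply/forall_inP/forall_inP => H a aU.
    have := H (val a); rewrite ffunE; case: insubP => [j _ /val_inj->|]; last by rewrite (valP a).
    by apply; rewrite inE in aU.
  rewrite ffunE; case: insubP => [j _ E|]; last by rewrite (subsetP UC).
  by apply: H; rewrite inE E.
exists r; split=> // [w|U UF]; last by rewrite rF // pF.
pose f (z : Omega) : R := (restrict C z == w)%:R.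
have fC : depends_on C f.
  move=> z z' /agreeP zz'; rewrite /f; congr ((_ == _)%:R).
  by apply/ffunP => i; rewrite !ffunE zz' // (valP i).
have -> : @marginal R A C r w = expect r f.
  rewrite /marginal big_mkcond; apply: eq_bigr => z _; rewrite /f.
  by case: ifP; rewrite ?mulr1 ?mulr0.
rewrite (rC f fC) expE (bigD1 w) //= /f extK eqxx mulr1 big1 ?addr0 // => w' ww'.
by rewrite extK (negPf ww') mulr0.
Qed.

(* If [x] and [y] are two nonadjacent items of [C] joined by a path outside
   [C], let the items of the path share one fair coin: this forces [x] and [y]
   to agree, although the frequencies inside [C] allow independent coins. *)
Lemma safe_convex (C : {set A}) : safe R F C -> convex e setT C.
Proof.
move=> safeC x y p xC yC xp pC; apply: contrapT => /not_orP[/eqP nxy nexy].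
pose Z := [set a in x :: rcons p y].
have xZ : x \in Z by rewrite !inE eqxx.
have yZ : y \in Z by rewrite !inE mem_rcons mem_head orbT.
pose mk (b : bool) : Omega := [ffun a => b && (a \in Z)].
pose p0 := pushforward (fun=> 2^-1 : R) mk.
have p0E f : expect p0 f = 2^-1 * f (mk true) + 2^-1 * f (mk false).
  by rewrite /expect sum_pushforward big_bool.
have p0D : distribution p0.
  by apply: distribution_pushforward => [b|]; rewrite ?big_bool /=; lra.
pose xi : {a | a \in C} := Sub x xC; pose yi : {a | a \in C} := Sub y yC.
pose mq (bc : bool * bool) : {ffun {a | a \in C} -> bool} :=
  [ffun i => ((i == xi) && bc.1) || ((i == yi) && bc.2)].
(* Two independent fair coins at [x] and [y], zeros elsewhere in [C]. *)
pose q := pushforward (fun=> 4^-1 : R) mq.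
have sum4 (f : bool * bool -> R) : \sum_bc f bc =
    f (true, true) + f (true, false) + (f (false, true) + f (false, false)).
  have := pair_bigA +%R (fun b c => f (b, c)); rewrite /= !big_bool => ->.
  by apply: eq_bigr => -[].
have qE f : \sum_w q w * f w = 4^-1 * f (mq (true, true)) + 4^-1 * f (mq (true, false)) +
    (4^-1 * f (mq (false, true)) + 4^-1 * f (mq (false, false))).
  by rewrite sum_pushforward sum4.
have qD : distribution q.
  by apply: distribution_pushforward => [b|]; rewrite ?sum4 /=; lra.
have xyi : xi == yi = false by apply/negbTE; rewrite -val_eqE.
have mqx bc : mq bc xi = bc.1 by rewrite ffunE eqxx xyi /= orbF.
have mqy bc : mq bc yi = bc.2 by rewrite ffunE eq_sym xyi eqxx.
have freqE (U : {set A}) : U \in F -> U \subset C ->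
    frequency q (itemset_in C U) = frequency p0 U.
  move=> UF UC; rewrite /frequency p0E /expect qE.
  (* The path avoids [C], so [Z] meets [C] only in [x] and [y]. An itemset with a third item has
     frequency 0 on both sides, and none in [F] contains both [x] and [y]. *)
  have [a /andP[aU /andP[ax ay]]|none] := pickP [pred a in U | (a != x) && (a != y)].
    have aC := subsetP UC a aU.
    have aZ : a \notin Z.
      rewrite !inE mem_rcons inE (negPf ax) (negPf ay) /=.
      by apply/negP => /pC; rewrite inE aC.
    have z1 b : all_ones U (mk b) = false.
      by apply/negbTE/forall_inP => /(_ a aU); rewrite ffunE (negPf aZ) andbF.
    have z2 bc : all_ones (itemset_in C U) (mq bc) = false.
      apply/negbTE/forall_inP => /(_ (Sub a aC)); rewrite inE /= => /(_ aU).
      by rewrite ffunE -!val_eqE /= (negPf ax) (negPf ay).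
    by rewrite !z1 !z2; lra.
  have Uxy a : a \in U -> a = x \/ a = y.
    move=> aU; have := none a; rewrite /= aU /=.
    by have [->|_] := eqVneq a x; [left | have [->|] := eqVneq a y; [right |]].
  have z1 b : all_ones U (mk b) = ((x \in U) || (y \in U) ==> b).
    apply/forall_inP/implyP => [H|H a aU].
      by case/orP => /H; rewrite ffunE => /andP[].
    by rewrite ffunE; case: (Uxy a aU) => E; rewrite E ?xZ ?yZ andbT; apply: H;
      rewrite -E aU ?orbT.
  have z2 bc : all_ones (itemset_in C U) (mq bc) =
      ((x \in U) ==> bc.1) && ((y \in U) ==> bc.2).
    apply/forall_inP/andP => [H|[/implyP Hx /implyP Hy] a].
      by split; apply/implyP => aU; [rewrite -mqx | rewrite -mqy]; apply: H; rewrite inE.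
    rewrite inE => aU; case: (Uxy _ aU) => E.
      by rewrite (_ : a = xi) ?mqx ?Hx -?E //; apply: val_inj.
    by rewrite (_ : a = yi) ?mqy ?Hy -?E //; apply: val_inj.
  rewrite !z1 !z2 /=; case xU: (x \in U); case yU: (y \in U) => /=; try lra.
  by case: nexy; apply: itemset_adj UF xU yU nxy.
have [|r [[r0 _] rC rF]] := safeC (frequency p0) _ q qD freqE; first by exists p0.
(* The sets [[set u]] and [[set u; v]] both have frequency 1/2, so [r] charges no point with a one
   at [u] and a zero at [v]. *)
have edge u v z : e u v -> u \in Z -> v \in Z -> r z != 0 -> z u -> z v.
  move=> euv uZ vZ rz zu; apply: contraT => zv.
  have uvF : [set u; v] \in F by case/andP: euv.
  have uF : [set u] \in F by apply: F_antimonotonic uvF _; apply: subsetUl.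
  have half (U : {set A}) : U \subset Z -> U != set0 -> frequency p0 U = 2^-1.
    move=> UZ /set0Pn[a aU]; rewrite /frequency p0E.
    have -> : all_ones U (mk true).
      by apply/forall_inP => b bU; rewrite ffunE (subsetP UZ).
    have -> : all_ones U (mk false) = false.
      by apply/negbTE/forall_inP => /(_ a aU); rewrite ffunE.
    by rewrite mulr1 mulr0 addr0.
  have : frequency r [set u] - frequency r [set u; v] = 0.
    rewrite !rF // !half ?subrr // ?subUset ?sub1set ?uZ //.
    - by apply/set0Pn; exists u; rewrite !inE eqxx.
    - by apply/set0Pn; exists u; rewrite !inE eqxx.
  rewrite /frequency /expect -sumrB => S0.
  have term0 t : 0 <= r t * (all_ones [set u] t)%:R - r t * (all_ones [set u; v] t)%:R.
    rewrite -mulrBr mulr_ge0 // subr_ge0 ler_nat.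
    case E: (all_ones [set u; v] t) => //.
    by rewrite (_ : all_ones _ t) //; apply/forall_inP => a /set1P->;
      move/forall_inP: E; apply; rewrite !inE eqxx.
  have : r z * (all_ones [set u] z)%:R - r z * (all_ones [set u; v] z)%:R = 0.
    exact: (psumr_eq0P (fun t _ => term0 t) S0).
  rewrite -mulrBr.
  have -> : all_ones [set u] z by apply/forall_inP => a /set1P->.
  have -> : all_ones [set u; v] z = false.
    by apply/negbTE/forall_inP => /(_ v); rewrite !inE eqxx orbT (negPf zv) => /(_ isT).
  by rewrite subr0 mulr1 => E; rewrite E eqxx in rz.
have along z s v : r z != 0 -> path e v s -> {subset v :: s <= Z} -> z v -> z (last v s).
  move=> rz; elim: s v => //= u s IHs v /andP[evu us] sZ zv; apply: IHs => //.
    by move=> a aus; apply: sZ; rewrite inE aus orbT.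
  by apply: (edge v) => //; apply: sZ; rewrite !inE eqxx ?orbT.
(* The event of a one at [x] and a zero at [y] has probability 1/4 under [q] but 0 under [r]. *)
pose g (w : {ffun {a | a \in C} -> bool}) : R := (w xi && ~~ w yi)%:R.
have : \sum_w q w * g w = 4^-1.
  by rewrite qE /g !mqx !mqy /=; lra.
have <- : \sum_w @marginal R A C r w * g w = \sum_w q w * g w.
  by apply: eq_bigr => w _; rewrite rC.
rewrite (sum_pushforward r (@restrict A C) g) big1 => [|z _]; first by lra.
rewrite /g !ffunE /=; have [->|rz] := eqVneq (r z) 0; first by rewrite mul0r.
case zx: (z x); last by rewrite mulr0.
have := along z _ x rz xp; rewrite last_rcons => -> //; first by rewrite mulr0.
by move=> a ap; rewrite inE.
Qed.

End SafeConvex.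

(** * Inner separators *)

Section JunctionTree.
Variables (A : finType) (F : {set {set A}}).
Local Notation e := (dependency_graph F).
Variables (par : clique F -> clique F) (rank : clique F -> nat) (root : clique F).
Hypothesis par_root : par root = root.
Hypothesis rank_par : forall K, K != root -> rank (par K) < rank K.
Hypothesis items_top : forall a, exists2 K, a \in items K &
  forall L, a \in items L -> L != K -> L != root /\ a \in items (par L).

Implicit Types K L M N : clique F.

Local Notation T := (parent_rel par).
Local Notation items_cut := (bag_cut (bag := @items A F) rank_par items_top).

Lemma adj_clique x y : e x y -> exists K : clique F, x \in items K /\ y \in items K.
Proof.
move=> exy; have [|K] := @clique_exists _ F [set x; y].
  by move=> u v /set2P[]-> /set2P[]->; rewrite ?eqxx // dependency_sym.
by rewrite subUset !sub1set => /andP[xK yK]; exists K.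
Qed.

(** With an empty separator, [bag_cut] keeps all cliques of an item on one side of the edge.
    Adjacent items share a clique, so no walk in the graph could change sides. *)
Lemma separator_neq0 K : connected_graph e -> K != root -> items K :&: items (par K) != set0.
Proof.
move=> conn Kr; apply/negP => /eqP disj.
have nK := not_below_par par_root rank_par Kr.
have neq : K != par K by apply: contraNneq nK => <-; apply: below_refl.
have nonempty L M : L != M -> exists a, a \in items L.
  move=> LM; apply/set0Pn; apply: contraNneq LM => L0; apply/eqP.
  by apply: clique_maximal; rewrite L0 sub0set.
have [a aK] := nonempty _ _ neq; rewrite eq_sym in neq; have [b bP] := nonempty _ _ neq.
have cut x M N : x \in items M -> x \in items N -> below par K M -> below par K N.
  move=> xM xN KM; apply: contraT => KN.
  by have [xK xP] := items_cut xM xN KM KN; move/setP/(_ x): disj; rewrite !inE xK xP.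
have stay x y M : x \in items M -> below par K M -> e x y ->
    exists2 N, y \in items N & below par K N.
  by move=> xM KM /adj_clique[N [xN yN]]; exists N; last exact: cut xM xN KM.
have walk p x M : x \in items M -> below par K M -> path e x p ->
    exists2 N, last x p \in items N & below par K N.
  elim: p x M => [|y p IHp] x M xM KM; first by exists M.
  by move=> /= /andP[/(stay _ _ _ xM KM)[N yN KN]]; apply: IHp yN KN.
have /connectP[p ap bE] := conn a b.
have [M bM KM] := walk p a K aK (below_refl par K) ap.
by rewrite -bE in bM; have := cut _ _ _ bM bP KM; rewrite (negPf nK).
Qed.

Lemma parent_junction_tree : connected_graph e -> junction_tree T.
Proof.
move=> conn; split; first exact: parent_rel_tree par_root rank_par.
  move=> K L KL; rewrite /clique_graph; case/andP: (KL) => -> _ /=.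
  case: (parent_relE par_root KL) => -[nr ->]; first exact: separator_neq0.
  by rewrite setIC; apply: separator_neq0.
by move=> a K L p aK aL; apply: (bag_path (bag := @items A F) par_root rank_par items_top).
Qed.

Lemma inner_separatorsP (B : {set A}) (Q : A -> clique F) s :
  reflect (exists2 n, separated par root B Q n & s = [set n; par n])
          (s \in inner_separators T B Q).
Proof.
rewrite inE; apply: (iffP (asboolP _)) => [[b [c [p [bB cB bp sp]]]]|].
  have /(simple_path_edgesP par_root rank_par _ bp)[n [nr sE nb]] := sp.
  by exists n => //; split=> //; exists b, c.
move=> [n [nr [b [c [bB cB nb]]]] sE].
have [p bp] := simple_path_exists rank_par (Q b) (Q c).
by exists b, c, p; split=> //; apply/(simple_path_edgesP par_root rank_par _ bp); exists n.
Qed.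

Lemma separator_itemsE K : separator_items [set K; par K] = items K :&: items (par K).
Proof.
apply/setP => x; apply/bigcapP/setIP => [H|[xK xP] L /set2P[]->//].
by split; apply: H; rewrite !inE eqxx ?orbT.
Qed.

(* Otherwise the choice could be pulled back out of the part below [n], and
   the edge above [n] saved. *)
Lemma minimising_separated (B : {set A}) (Q : A -> clique F) n :
  minimising_choice T B Q -> separated par root B Q n ->
  exists2 b, b \in B & forall K, b \in items K -> below par n K.
Proof.
move=> [QB Qmin] sn; apply: contrapT => none.
have outB : {in B, forall b, exists2 K, b \in items K & ~~ below par n K}.
  move=> b bB; apply: contrapT => nK; apply: none; exists b => // K bK.
  by apply: contraT => nb; case: nK; exists K.
have [Q' [Q'B Q'n Q's]] := bag_reroute (bag := @items A F) par_root rank_par items_top sn.1 QB outB.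
have := Qmin Q' Q'B; rewrite leqNgt => /negP; apply; apply: proper_card.
apply/properP; split.
  by apply/subsetP => s /inner_separatorsP[m /Q's sm ->]; apply/inner_separatorsP; exists m.
exists [set n; par n]; first by apply/inner_separatorsP; exists n.
apply/inner_separatorsP => -[m sm E].
(* An edge determines its lower end: otherwise [n] and [m] would be parents of each other, against
   the rank. *)
have nm : n = m.
  have [//|nm] := eqVneq n m.
  have : n \in [set m; par m] by rewrite -E !inE eqxx.
  have : m \in [set n; par n] by rewrite E !inE eqxx.
  rewrite !inE (negPf nm) eq_sym (negPf nm) /= => /eqP mE /eqP nE.
  have := rank_par sn.1; have := rank_par sm.1; rewrite -mE -nE => nltm mltn.
  by have := ltn_trans nltm mltn; rewrite ltnn.
case: sm => _ [b [c [bB cB]]]; rewrite -nm.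
by rewrite (negPf (Q'n b bB)) (negPf (Q'n c cB)).
Qed.

Definition hull (B : {set A}) (Q : A -> clique F) : {set A} :=
  B :|: \bigcup_(s in inner_separators T B Q) separator_items s.

Lemma hullP (B : {set A}) (Q : A -> clique F) x :
  reflect (x \in B \/ exists2 n, separated par root B Q n & x \in items n :&: items (par n))
          (x \in hull B Q).
Proof.
apply: (iffP setUP) => -[xB|H]; [by left | right | by left | right].
  case/bigcupP: H => s /inner_separatorsP[n sn ->]; rewrite separator_itemsE.
  by exists n.
case: H => n sn xn; apply/bigcupP; exists [set n; par n].
  by apply/inner_separatorsP; exists n.
by rewrite separator_itemsE.
Qed.

(* If no clique contains both ends of a path outside the hull, some edge of the
   tree separates the cliques of one end from those of the other. An item of
   the path lies in this separator, which is inner since both ends belong to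
   the hull. *)
Lemma hull_convex (B : {set A}) (Q : A -> clique F) :
  clique_choice B Q -> convex e setT (hull B Q).
Proof.
move=> QB x y p xH yH xp pH.
have [[K [xK yK]]|[n nr sep]] := bag_helly (bag := @items A F) par_root rank_par items_top x y.
  by have [->|xy] := eqVneq x y; [left | right; apply: (clique_adj xK yK)].
exfalso.
have [M0 xM0 _] := items_top x; have [N0 yN0 _] := items_top y.
have side_x M : x \in items M -> below par n M = below par n M0.
  by move=> xM; have := sep _ _ xM yN0; have := sep _ _ xM0 yN0; do 3 case: below.
have side_y N : y \in items N -> below par n N = below par n N0.
  by move=> yN; have := sep _ _ xM0 yN; have := sep _ _ xM0 yN0; do 3 case: below.
(* An end [z] outside [B] lies in an inner separator whose edge is on the side of [z];
   [separated_laminar] then supplies a chosen clique on that side. *)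
have base z M : z \in hull B Q -> z \in items M ->
    (forall N, z \in items N -> below par n N = below par n M) ->
    exists2 b, b \in B & below par n (Q b) = below par n M.
  move=> /hullP[zB|[m sm /setIP[zm zpm]]] zM side.
    by exists z => //; apply/side/QB.
  have [|b bB bE] := separated_laminar (n := n) sm.
    by rewrite (side m) ?(side (par m)).
  by exists b; rewrite // bE side.
have [b bB bE] := base x M0 xH xM0 side_x.
have [c cB cE] := base y N0 yH yN0 side_y.
have sn : separated par root B Q n.
  by split=> //; exists b, c; rewrite bE cE; split=> //; apply: sep.
have stay v M N : v \in p -> v \in items M -> v \in items N ->
    below par n M -> below par n N.
  move=> /pH; rewrite inE => /andP[vH _] vM vN nM; apply: contraT => nN.
  case/negP: vH; apply/hullP; right; exists n => //.
  by apply/setIP; apply: items_cut vM vN nM nN.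
(* Items of the path avoid the hull, hence the separator, so the walk stays on the side of [x] and
   cannot reach [y]. *)
suff walk s v : {subset s <= p} -> path e v (rcons s y) ->
    ~ (forall M, v \in items M -> below par n M = below par n M0).
  exact: (walk p x (fun v vp => vp) xp side_x).
elim: s v => [|u s IHs] v sp /=.
  rewrite andbT => /adj_clique[K [vK yK]] side_v.
  by have := sep _ _ xM0 yK; rewrite side_v ?eqxx.
move=> /andP[/adj_clique[K [vK uK]] us] side_v.
apply: (IHs u _ us) => [w ws|M uM]; first by apply: sp; rewrite inE ws orbT.
have up : u \in p by apply: sp; rewrite mem_head.
by rewrite -(side_v K vK); apply/idP/idP; apply: (stay u).
Qed.

End JunctionTree.

(** * The least convex set and the theorem *)

Lemma minimum_convex (A : finType) (e : rel A) (B : {set A}) : symmetric e ->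
  exists C, [/\ convex e setT C, B \subset C &
    forall D, convex e setT D -> B \subset D -> C \subset D].
Proof.
move=> e_sym; pose P (D : {set A}) := `[< convex e setT D >] && (B \subset D).
have PT : P setT.
  rewrite /P subsetT andbT; apply/asboolP => x y [|u p] _ _.
    by rewrite /= andbT => exy _; right.
  by move=> _ /(_ u (mem_head _ _)); rewrite !inE.
have [C /andP[/asboolP cC BC] Cmin] := @arg_minnP _ setT P (fun D => #|D|) PT.
(* [C :&: D] is again convex and contains [B], so it cannot be smaller than [C]. *)
exists C; split=> // D cD BD; apply/setIidPl/eqP; rewrite eqEcard subsetIl /=.
apply: Cmin; rewrite /P subsetI BC BD !andbT; apply/asboolP.
exact: convexI.
Qed.

Theorem theorem8 (R : realType) (A : finType) (F : {set {set A}})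
    (B : {set A})
    (F_antimonotonic : antimonotonic F)
    (F_triangulated : triangulated F)
    (F_clique_safe : clique_safe F)
    (G_connected : connected_graph (dependency_graph F)) :
  exists T : rel (clique F),
    junction_tree T /\
    forall Q : A -> clique F, minimising_choice T B Q ->
    forall C : {set A},
      minimum_safe_set R F B C <->
      C = B :|: \bigcup_(s in inner_separators T B Q) separator_items s.
Proof.
have [C0 [cC0 BC0 C0min]] := minimum_convex B (@dependency_sym _ F).
have [rho [rho_inj rho_C0 rho_lt rho_elim]] := elimination_ordering
  (@dependency_sym _ F) (@dependency_irr _ F) F_triangulated (subsetT C0) cC0.
have [x y|x|v x y exv exy|par [rank [root [par_root rank_par items_top sep_lt]]]] :=
    @clique_tree _ F rho.
- exact: rho_inj.
- by rewrite -cardsT; apply: rho_lt.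
- exact: rho_elim.
exists (parent_rel par); split; first exact: parent_junction_tree par_root rank_par items_top _.
move=> Q Qmin C; rewrite -/(hull par B Q).
have BH : B \subset hull par B Q by apply: subsetUl.
have cH : convex (dependency_graph F) setT (hull par B Q).
  exact: hull_convex par_root rank_par items_top _ _ Qmin.1.
have <- : C0 = hull par B Q.
  apply/eqP; rewrite eqEsubset C0min //=; apply/subsetP => x.
  case/(hullP par_root rank_par) => [|[n sn xn]]; first exact: (subsetP BC0).
  (* The separator item [x] precedes this [b] of [B] in [rho], and [C0] is an initial segment
     containing [b]. *)
  have [b bB bn] := minimising_separated par_root rank_par items_top Qmin sn.
  have xb := sep_lt n b sn.1 bn x xn.
  apply: contraLR xb => xC0; rewrite -leqNgt; apply/ltnW/rho_C0.
    exact: (subsetP BC0).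
  by rewrite !inE xC0.
(* Inclusion of [C0] in every competitor makes the safe set of minimum cardinality unique. *)
have safe_min D : safe R F D -> B \subset D -> C0 \subset D.
  by move=> /(safe_convex F_antimonotonic) cD; apply: C0min.
have safeC0 : safe R F C0 by apply: convex_safe.
split=> [[safeC BC Cmin]|->]; last first.
  by split=> // D safeD BD; apply/subset_leq_card/safe_min.
by apply/esym/eqP; rewrite eqEcard safe_min // Cmin.
Qed.
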